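(* Let $k\ge1$ be an integer and $m,p\in\mathbb{N}$ with $m\le p$. Suppose that $f=h+\overline{g}$ is harmonic in $\mathbb{D}$, where $h(z)=\sum_{n=k}^{\infty}a_{pn+m}z^{pn+m}$ and $g(z)=\sum_{n=k}^{\infty}b_{pn+m}z^{pn+m}$ are analytic in $\mathbb{D}$. In addition, let $|g'(z)|\le d|h'(z)|$ in $\mathbb{D}\setminus\{0\}$ for some $d\in[0,1]$ and $h\in\mathcal{B}_{pk+m}$. Define $$M_{pk+m}(h,r)=\sum_{n=k}^{\infty}|a_{pn+m}|r^{pn+m}+\left(\frac1{1+|a_{pk+m}|}+\frac{r^p}{1-r^p}\right)\sum_{n=k}^{\infty}|a_{pn+m}|^2r^{p(2n-k)+m}$$ and $$N_{pk+m}(g,r)=\sum_{n=k}^{\infty}|b_{pn+m}|r^{pn+m}+\left(\frac1{1+|a_{pk+m}|}+\frac{r^p}{1-r^p}\right)\sum_{n=k}^{\infty}|b_{pn+m}|^2r^{p(2n-k)+m}.$$ Then the inequality $$M_{pk+m}(h,r)+N_{pk+m}(g,r)\le1$$ is valid for $r\in[0,r_k]$, where $r_k=\min\{r_k',1/\sqrt[p]{3}\}$ and $r_k'$ is the unique root in $(0,1)$ of the equation $t_k(r)=0$, with $$t_k(r)=\frac{2}{d+1}(1-r^p)-r^{pk+m}(3-r^p).$$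
   Context: $\mathbb{D}=\{z\in\mathbb{C}:|z|<1\}$ and $\mathbb N=\{1,2,\dots\}$. $\mathcal{B}$ is the class of analytic functions $\phi$ on $\mathbb{D}$ with $\sup_{z\in\mathbb{D}}|\phi(z)|\le1$, and for $j\in\mathbb{N}$, $\mathcal{B}_j=\{\phi\in\mathcal{B}:\phi(0)=\cdots=\phi^{(j-1)}(0)=0\}$. *)

(* Defs.v *)
From mathcomp Require Export all_boot all_order all_algebra.
From mathcomp Require Export all_classical all_reals all_analysis.
From mathcomp Require Export complex.
Set Implicit Arguments.
Unset Strict Implicit.
Unset Printing Implicit Defensive.
Export Order.TTheory GRing.Theory Num.Theory numFieldNormedType.Exports.
Local Open Scope ring_scope.
Local Open Scope classical_set_scope.
Local Open Scope complex_scope.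

(* The complex numbers over [R], as a normed space over themselves: the
   topology and [derivable]/[^`()] below are complex ones.  The native norm
   [`|z|] takes values in [R[i]]; [Normc.normc z : R] is the real modulus. *)
Notation Cplx R := ((R[i])^o)%type.

Definition unit_disc (R : realType) : set (Cplx R) :=
  [set z | Normc.normc z < 1].

Definition analytic_in_disc (R : realType) (f : Cplx R -> Cplx R) : Prop :=
  forall z, unit_disc z -> derivable f z 1.

(* Real harmonicity on an open set [A] of the plane: [u] is C^2 on [A] with
   zero Laplacian. *)
Definition real_harmonic (R : realType) (A : set (R * R)) (u : R * R -> R) :
    Prop :=
  (forall z e e' : R * R, A z ->
     e \in [:: (1, 0); (0, 1)] -> e' \in [:: (1, 0); (0, 1)] ->
     [/\ derivable u z e, derivable ('D_e u) z e' &
         {for z, continuous ('D_e' ('D_e u))}]) /\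
  (forall z : R * R, A z ->
     'D_(1, 0) ('D_(1, 0) u) z + 'D_(0, 1) ('D_(0, 1) u) z = 0).

Definition harmonic_in_disc (R : realType) (f : Cplx R -> Cplx R) : Prop :=
  let A := [set z : R * R | unit_disc (z.1 +i* z.2)] in
  real_harmonic A (fun z => complex.Re (f (z.1 +i* z.2))) /\
  real_harmonic A (fun z => complex.Im (f (z.1 +i* z.2))).

Definition classB (R : realType) (phi : Cplx R -> Cplx R) : Prop :=
  analytic_in_disc phi /\
  (ereal_sup [set (Normc.normc (phi z))%:E | z in @unit_disc R] <= 1)%E.

Definition classB_ (R : realType) (j : nat) (phi : Cplx R -> Cplx R) : Prop :=
  classB phi /\ forall i, (i < j)%N -> phi^`(i) 0 = 0.

(* [phi(z) = \sum_(n >= k) c_(pn+m) z^(pn+m)] for every [z] in the disc.  Only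
   the values of [c] at the indices [pn+m], [n >= k], matter. *)
Definition has_expansion (R : realType) (k m p : nat) (phi : Cplx R -> Cplx R)
    (c : nat -> R[i]) : Prop :=
  forall z, unit_disc z ->
    ((fun N : nat =>
       \sum_(k <= n < N) c (p * n + m)%N * z ^+ (p * n + m)) : nat -> Cplx R)
      @ \oo --> phi z.

(* The common shape of M and N: [alpha] is the modulus |a_(pk+m)|, and [c] is
   the coefficient sequence.  The series have nonnegative terms and are summed
   in [\bar R], so that a divergent one has value [+oo].  In the exponent,
   [2 * n - k] does not truncate since [n >= k]. *)
Definition bohr_sum (R : realType) (k m p : nat) (alpha : R) (c : nat -> R[i])
    (r : R) : \bar R :=
  (\sum_(k <= n <oo) (Normc.normc (c (p * n + m)%N) * r ^+ (p * n + m))%:E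
   + ((1 + alpha)^-1 + r ^+ p / (1 - r ^+ p))%:E
     * \sum_(k <= n <oo)
         (Normc.normc (c (p * n + m)%N) ^+ 2
          * r ^+ (p * (2 * n - k) + m))%:E)%E.

Definition M_ (R : realType) (k m p : nat) (a : nat -> R[i]) (r : R) : \bar R :=
  bohr_sum k m p (Normc.normc (a (p * k + m)%N)) a r.

Definition N_ (R : realType) (k m p : nat) (a b : nat -> R[i]) (r : R) :
    \bar R :=
  bohr_sum k m p (Normc.normc (a (p * k + m)%N)) b r.

Definition t_ (R : realType) (k m p : nat) (d r : R) : R :=
  2 / (d + 1) * (1 - r ^+ p) - r ^+ (p * k + m) * (3 - r ^+ p).

(* Main.v *)
(* With s = r^p <= 1/3, write h(z) = z^(pk+m) phi(z^p), where phi is again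
   bounded by 1.  Parseval, in the form of averages over roots of unity, says
   that multiplication by phi is a contraction for the l^2 norm of the
   coefficients; applied to well chosen polynomials this gives Carlson's
   coefficient inequalities, and summing them gives M <= r^(pk+m) (3/2 + s/(1-s)).
   For g, the quotient omega = g'/h' is a power series in z^p bounded by d: one
   divides out the zeros of h' in a disc by Blaschke factors, after which 1/h' is
   a limit of inverses of zero-free polynomials.  Hence l^2 domination, and
   Bohr's inequality for omega gives l^1 domination for s <= 1/3, first for
   the coefficients of the derivatives and then, by Abel summation, for those of
   g and h.  So N obeys d times the bound for M, and the sum of the two bounds is
   at most 1 as soon as t_k(r) >= 0. *)

(* A bound on the modulus is used only through the quadratic inequality [contr], whose instances
   each involve finitely many coefficients. It therefore survives a limit of radii tending to 1, and
   it can be asked of a formal power series. This matters for omega: where h' vanishes there is no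
   quotient of values, so omega is defined by recursion on coefficients, and its l^2 inequality is
   proved on each smaller disc separately. There the number of zeros to divide out is bounded in
   advance, since each division enlarges the value at 0, which the maximum on a circle controls. The
   variable w = z^p suits the derivatives as well: g'(z) and h'(z) share the factor z^(pk+m-1),
   which cancels from |g'| <= d|h'|. *)
Require Import Defs.
From mathcomp Require Import cyclic separable cyclotomic ring lra zify.
Local Open Scope ring_scope.
Local Open Scope classical_set_scope.
Local Open Scope complex_scope.
Set Implicit Arguments.
Unset Strict Implicit.
Unset Printing Implicit Defensive.

(** * The modulus, and Parseval over roots of unity *)

Section Modulus.
Variable R : realType.
Local Notation C := R[i].
Local Notation nm := (@Normc.normc R).
Implicit Types x y z : C.

Lemma nm_ge0 x : 0 <= nm x.
Proof. by case: x => a b; rewrite /Normc.normc sqrtr_ge0. Qed.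

Lemma nm0 : nm 0 = 0. Proof. exact: Normc.normc0. Qed.
Lemma nm1 : nm 1 = 1. Proof. exact: Normc.normc1. Qed.

Lemma nm_eq0 x : (nm x == 0) = (x == 0).
Proof. by apply/eqP/eqP => [/Normc.eq0_normc //|->]; rewrite nm0. Qed.

Lemma nm_gt0 x : (0 < nm x) = (x != 0).
Proof. by rewrite lt_def nm_eq0 nm_ge0 andbT. Qed.

Lemma nmM x y : nm (x * y) = nm x * nm y.
Proof. exact: Normc.normcM. Qed.

Lemma nmV x : nm x^-1 = (nm x)^-1.
Proof. exact: Normc.normcV. Qed.

Lemma nmX x n : nm (x ^+ n) = nm x ^+ n.
Proof. by elim: n => [|n IH]; rewrite ?nm1 // !exprS nmM IH. Qed.

Lemma nmD x y : nm (x + y) <= nm x + nm y.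
Proof. exact: le_normcD. Qed.

Lemma nmN x : nm (- x) = nm x.
Proof. exact: normcN. Qed.

Lemma nmB x y : nm (x - y) <= nm x + nm y.
Proof. by rewrite -(nmN y); exact: nmD. Qed.

Lemma nm_distC x y : nm (x - y) = nm (y - x).
Proof. by rewrite -nmN opprB. Qed.

Lemma nm_dist_le x y : nm x <= nm y + nm (x - y).
Proof. by have := nmD y (x - y); rewrite addrC subrK. Qed.

Lemma nm_dist_le' x y : nm x <= nm y + nm (y - x).
Proof. by rewrite nm_distC; exact: nm_dist_le. Qed.

Lemma norm_nm (z : Cplx R) : `|z| = (nm z)%:C.
Proof. by rewrite normc_def; case: z. Qed.

Lemma nm_real (a : R) : nm a%:C = `|a|.
Proof. by rewrite /Normc.normc /= expr0n /= addr0 sqrtr_sqr. Qed.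

Lemma nm_nat n : nm n%:R = n%:R.
Proof.
have -> : (n%:R : C) = (n%:R : R)%:C by rewrite raddfMn /=.
by rewrite nm_real normr_nat.
Qed.

Lemma nm_sum (I : Type) (r : seq I) (P : pred I) (F : I -> C) :
  nm (\sum_(i <- r | P i) F i) <= \sum_(i <- r | P i) nm (F i).
Proof.
elim/big_rec2: _ => [|i u v _ h]; first by rewrite nm0.
exact: le_trans (nmD _ _) (lerD _ _).
Qed.

Lemma mul_conj x : x * x^* = (nm x ^+ 2)%:C.
Proof.
case: x => a b; rewrite /Normc.normc sqr_sqrtr ?addr_ge0 ?sqr_ge0 //.
by apply/eqP; rewrite eq_complex /=; apply/andP; split; apply/eqP; ring.
Qed.

Lemma nm_conj x : nm x^* = nm x.
Proof. by case: x => a b; rewrite /Normc.normc /= sqrrN. Qed.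

Lemma nm_Re x : `|complex.Re x| <= nm x.
Proof.
case: x => a b /=; rewrite -sqrtr_sqr ler_sqrt ?addr_ge0 ?sqr_ge0 //.
by rewrite lerDl sqr_ge0.
Qed.

Lemma nm_Im x : `|complex.Im x| <= nm x.
Proof.
case: x => a b /=; rewrite -sqrtr_sqr ler_sqrt ?addr_ge0 ?sqr_ge0 //.
by rewrite lerDr sqr_ge0.
Qed.

Lemma nm_ReIm x : nm x <= `|complex.Re x| + `|complex.Im x|.
Proof.
case: x => a b /=; rewrite -[leRHS]ger0_norm ?addr_ge0 // -sqrtr_sqr.
rewrite ler_sqrt ?sqr_ge0 // sqrrD !real_normK ?num_real //.
by rewrite lerD2r lerDl mulrn_wge0 // mulr_ge0.
Qed.

Lemma unimodular_phase x : exists2 u : C, nm u = 1 & x = u * (nm x)%:C.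
Proof.
have [->|x0] := eqVneq x 0; first by exists 1; rewrite ?nm1 // nm0 mulr0.
have n0 : (nm x)%:C != 0 :> C.
  by rewrite -nm_gt0 nm_real normr_gt0 nm_eq0.
exists (x / (nm x)%:C); last by rewrite divfK.
by rewrite nmM nmV nm_real ger0_norm ?nm_ge0 // divff // nm_eq0.
Qed.

Lemma ex_prim_root n : (0 < n)%N -> exists z, n.-primitive_root z.
Proof.
move=> n_gt0; pose p : {poly C} := 'X^n - 1.
have [r Dp] := closed_field_poly_normal p.
rewrite (monicP _) ?monicXnsubC // scale1r in Dp.
have rn1 : all n.-unity_root r by apply/allP => z; rewrite -root_prod_XsubC -Dp.
have sz_r : (n < (size r).+1)%N.
  by rewrite -(size_prod_XsubC r id) -Dp size_XnsubC.
have [|z] := hasP (has_prim_root n_gt0 rn1 _ sz_r); last by exists z.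
by rewrite -separable_prod_XsubC -Dp separable_Xn_sub_1 // pnatr_eq0 -lt0n.
Qed.

(** Orthogonality of characters modulo [N]: for [n != m] the geometric sum of the
    [(z ^+ n / z ^+ m) ^+ j] vanishes, so only the diagonal of the expanded square remains. *)
Lemma finite_parseval N z (c : nat -> C) : N.-primitive_root z ->
  \sum_(j < N) nm (\sum_(n < N) c n * (z ^+ j) ^+ n) ^+ 2
  = N%:R * \sum_(n < N) nm (c n) ^+ 2.
Proof.
move=> zN; have N0 := prim_order_gt0 zN; have z1 := prim_expr_order zN.
have nz : nm z = 1.
  apply: (pexpIrn (n := N)); rewrite ?nnegrE ?nm_ge0 ?ler01 //.
  by rewrite -nmX z1 nm1 expr1n.
have zz : z * z^* = 1 by rewrite mul_conj nz expr1n.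
have orth (n m : 'I_N) :
    \sum_(j < N) (z ^+ n * (z^*) ^+ m) ^+ j = if n == m then N%:R else 0.
  have -> : z ^+ n * (z^*) ^+ m = z ^+ n / z ^+ m.
    congr (_ * _); rewrite -exprVn; congr (_ ^+ _).
    have z0 : z != 0 by rewrite -nm_gt0 nz ltr01.
    by apply: (mulfI z0); rewrite zz divff.
  have z0 : z ^+ m != 0 by rewrite -nm_gt0 nmX nz expr1n ltr01.
  case: eqVneq => [->|nm'].
    under eq_bigr do rewrite divff // expr1n.
    by rewrite sumr_const card_ord.
  set x := _ / _; have x1 : x - 1 != 0.
    rewrite subr_eq0; apply/eqP => e.
    have : z ^+ n == z ^+ m by rewrite -[z ^+ m]mul1r -e divfK.
    rewrite (eq_prim_root_expr zN) !modn_small // => /eqP /ord_inj e'.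
    by rewrite e' eqxx in nm'.
  apply: (mulfI x1); rewrite -subrX1 mulr0 /x expr_div_n.
  by rewrite -!exprM ![(_ * N)%N]mulnC !exprM z1 !expr1n divr1 subrr.
apply: (fmorph_inj (real_complex R)) => /=.
rewrite rmorphM /= rmorph_nat !rmorph_sum /=.
under eq_bigr => j _.
  rewrite -mul_conj rmorph_sum big_distrlr /=.
  over.
rewrite exchange_big mulr_sumr; apply: eq_bigr => n _ /=.
rewrite exchange_big (bigD1 n) //= [X in _ + X]big1 ?addr0 => [|m mn].
- under eq_bigr => j _.
    rewrite rmorphM !rmorphXn /= mulrACA mul_conj -!exprM ![(j * _)%N]mulnC.
    rewrite !exprM -exprMn.
    over.
  by rewrite -mulr_sumr orth eqxx mulrC.
- under eq_bigr => j _.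
    rewrite rmorphM !rmorphXn /= mulrACA -!exprM ![(j * _)%N]mulnC.
    rewrite !exprM -exprMn.
    over.
  by rewrite -mulr_sumr orth eq_sym (negbTE mn) mulr0.
Qed.

End Modulus.

(* Otherwise unification and [lra] compare moduli by unfolding them. *)
Opaque Normc.normc.

(** * Power series *)

Section PowerSeries.
Variable R : realType.
Local Notation C := R[i].
Local Notation nm := (@Normc.normc R).
Implicit Types (u : nat -> C) (v w : C) (c e q : nat -> C).

Lemma geometric_le (x : R) N : 0 <= x < 1 -> \sum_(n < N) x ^+ n <= (1 - x)^-1.
Proof.
move=> /andP[x0 x1]; rewrite -[leRHS]mul1r ler_pdivlMr ?subr_gt0 // mulrC.
by rewrite -opprB mulNr -subrX1 opprB gerBl exprn_ge0.
Qed.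

Lemma expr_small (x : R) : 0 <= x < 1 ->
  forall eps, 0 < eps -> exists N0, forall N, (N0 <= N)%N -> x ^+ N <= eps.
Proof.
move=> /andP[x0 x1] eps e0.
have : (fun n => x ^+ n : R) @ \oo --> (0 : R).
  by apply: cvg_expr; rewrite ger0_norm.
move=> /cvgrPdist_le /(_ _ e0) [N0 _ h]; exists N0 => N /h /=.
by rewrite sub0r normrN ger0_norm // exprn_ge0.
Qed.

Lemma le_eps (a b : R) : (forall eps, 0 < eps -> a <= b + eps) -> a <= b.
Proof. by move=> h; apply/ler_addgt0Pr. Qed.

(* The native norm of [R[i]] takes values in [R[i]], and [R[i]] has no
   completeness instance, so limits are handled through real moduli and parts. *)
Definition cto u v := forall eps : R, 0 < eps ->
  exists N0, forall N, (N0 <= N)%N -> nm (v - u N) <= eps.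

Lemma cto_le u v (B : R) N1 : cto u v ->
  (forall N, (N1 <= N)%N -> nm (u N) <= B) -> nm v <= B.
Proof.
move=> uv uB; apply: le_eps => eps e0; have [N0 h] := uv _ e0.
apply: (le_trans (nm_dist_le v (u (maxn N0 N1)))).
by rewrite lerD ?uB ?h ?leq_maxl ?leq_maxr.
Qed.

Lemma cto_const v : cto (fun=> v) v.
Proof. by move=> eps /ltW e0; exists 0%N => N _; rewrite subrr nm0. Qed.

Lemma ctoD u v u' v' : cto u v -> cto u' v' -> cto (fun N => u N + u' N) (v + v').
Proof.
move=> h h' eps e0; have e2 : 0 < eps / 2 by rewrite divr_gt0.
have [N1 h1] := h _ e2; have [N2 h2] := h' _ e2.
exists (maxn N1 N2) => N; rewrite geq_max => /andP[a b].
have -> : v + v' - (u N + u' N) = (v - u N) + (v' - u' N) by ring.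
by apply: (le_trans (nmD _ _)); rewrite [eps]splitr lerD ?h1 ?h2.
Qed.

Lemma ctoZ (a : C) u v : cto u v -> cto (fun N => a * u N) (a * v).
Proof.
move=> h eps e0; have d0 : 0 < nm a + 1 by rewrite ltr_wpDl ?nm_ge0.
have [N0 h0] := h _ (divr_gt0 e0 d0).
exists N0 => N /h0 hN; rewrite -mulrBr nmM.
apply: (@le_trans _ _ ((nm a + 1) * (eps / (nm a + 1)))).
  by rewrite ler_pM ?nm_ge0 // lerDl.
by rewrite mulrC divfK // gt_eqF.
Qed.

Lemma ctoB u v u' v' : cto u v -> cto u' v' -> cto (fun N => u N - u' N) (v - v').
Proof.
move=> h /(ctoZ (-1)) h'; have := ctoD h h'.
by rewrite mulN1r; under eq_fun do rewrite mulN1r.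
Qed.

Lemma cto_sub D u v : cto u v -> cto (fun N => u (N - D)%N) v.
Proof.
move=> h eps /h [N0 h0]; exists (N0 + D)%N => N DN; apply: h0.
by rewrite leq_subRL ?(leq_trans _ DN) ?leq_addl // addnC.
Qed.

Lemma cto_unique u v v' : cto u v -> cto u v' -> v = v'.
Proof.
move=> h h'; apply/eqP; rewrite -subr_eq0 -nm_eq0 eq_le nm_ge0 andbT.
apply: (cto_le (N1 := 0) (ctoB h h')) => N _.
by rewrite subrr nm0.
Qed.

Lemma cto_cvg (u : nat -> Cplx R) (v : Cplx R) : u @ \oo --> v -> cto u v.
Proof.
move=> /cvgrPdist_le h eps e0.
have e0' : (0 : R[i]) < eps%:C by rewrite ltcR.
have [N0 _ h0] := h _ e0'; exists N0 => N /h0.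
by rewrite /= norm_nm lecR.
Qed.

Definition clim u : C :=
  limn (fun N => complex.Re (u N)) +i* limn (fun N => complex.Im (u N)).

Lemma cto_clim u (e : nat -> R) :
  (forall N M, (N <= M)%N -> nm (u M - u N) <= e N) ->
  (forall eps, 0 < eps -> exists N, e N <= eps) -> cto u (clim u).
Proof.
move=> ue e0.
have cv (f : C -> R) : (forall x y, `|f x - f y| <= nm (x - y)) ->
    cvgn (fun N => f (u N)).
  move=> fx; apply: cauchy_cvg; apply: cauchy_exP => eps eps0.
  have [N hN] := e0 _ (divr_gt0 eps0 (ltr0n _ 2)).
  exists (f (u N)), N => // M /= NM; rewrite /ball /= distrC.
  apply: (le_lt_trans (fx _ _)); apply: (le_lt_trans (ue _ _ NM)).
  by apply: (le_lt_trans hN); rewrite ltr_pdivrMr // ltr_pMr // ltr1n.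
have /cvgrPdist_le cR : cvgn (fun N => complex.Re (u N)).
  by apply: cv => x y; rewrite -raddfB nm_Re.
have /cvgrPdist_le cI : cvgn (fun N => complex.Im (u N)).
  by apply: cv => x y; rewrite -raddfB nm_Im.
move=> eps eps0; have eps2 : 0 < eps / 2 by rewrite divr_gt0.
have [N1 _ h1] := cR _ eps2; have [N2 _ h2] := cI _ eps2.
exists (maxn N1 N2) => N; rewrite geq_max => /andP[/h1 a /h2 b].
apply: (le_trans (nm_ReIm _)); rewrite [eps]splitr !raddfB /=.
exact: lerD a b.
Qed.

Definition psum c w N : C := \sum_(n < N) c n * w ^+ n.
Definition ev c w : C := clim (psum c w).
(** Bounded terms at radius [t], as in Abel's lemma: this gives convergence for moduli below [t],
    uniform on smaller discs. *)
Definition geo (t : R) c := exists B, forall n, nm (c n) * t ^+ n <= B.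

Lemma psum_diff_le c w (x B : R) N M : 0 <= x < 1 -> 0 <= B ->
  (forall n, nm (c n) * nm w ^+ n <= B * x ^+ n) -> (N <= M)%N ->
  nm (psum c w M - psum c w N) <= B / (1 - x) * x ^+ N.
Proof.
move=> x01 B0 cB NM; have /andP[x0 x1] := x01; rewrite /psum.
rewrite -!(big_mkord xpredT (fun n => c n * w ^+ n)).
rewrite (big_cat_nat _ NM) //= addrAC subrr add0r.
apply: (le_trans (nm_sum _ _ _)).
rewrite -{1}[N]add0n big_addn big_mkord.
apply: (@le_trans _ _ (\sum_(n < M - N) (B * x ^+ N) * x ^+ n)).
  apply: ler_sum => n _; rewrite nmM nmX -mulrA -exprD addnC.
  exact: cB.
rewrite -mulr_sumr mulrAC ler_wpM2r ?exprn_ge0 //.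
by rewrite ler_wpM2l // geometric_le.
Qed.

Lemma ratio_bound c w (t B : R) n : 0 < t -> (forall n, nm (c n) * t ^+ n <= B) ->
  nm (c n) * nm w ^+ n <= B * (nm w / t) ^+ n.
Proof.
move=> t0 cB; rewrite expr_div_n mulrA mulrAC ler_wpM2r ?exprn_ge0 ?nm_ge0 //.
by rewrite ler_pdivlMr ?exprn_gt0.
Qed.

Lemma ev_tail c w (t B : R) N : nm w < t -> (forall n, nm (c n) * t ^+ n <= B) ->
  cto (psum c w) (ev c w) /\
  nm (ev c w - psum c w N) <= B / (1 - nm w / t) * (nm w / t) ^+ N.
Proof.
move=> wt cB; have t0 := le_lt_trans (nm_ge0 w) wt.
have B0 : 0 <= B.
  by apply: le_trans (cB 0%N); rewrite mulr_ge0 ?nm_ge0 ?exprn_ge0 ?ltW.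
have x01 : 0 <= nm w / t < 1.
  by rewrite divr_ge0 ?nm_ge0 ?ltW //= ltr_pdivrMr ?mul1r.
have rb n := @ratio_bound c w t B n t0 cB.
have dl N' M (NM : (N' <= M)%N) := psum_diff_le x01 B0 rb NM.
have D0 : 0 <= B / (1 - nm w / t).
  by rewrite divr_ge0 ?subr_ge0 // ltW //; case/andP: x01.
have cv : cto (psum c w) (ev c w).
  apply: (cto_clim dl) => eps e0.
  have d0 : 0 < B / (1 - nm w / t) + 1 by rewrite ltr_wpDl.
  have [N1 h1] := expr_small x01 (divr_gt0 e0 d0).
  exists N1; apply: (@le_trans _ _ ((B / (1 - nm w / t) + 1) * (nm w / t) ^+ N1)).
    by rewrite ler_wpM2r ?exprn_ge0 ?lerDl //; case/andP: x01.
  by rewrite mulrC -ler_pdivlMr // h1.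
split=> //; apply: (cto_le (N1 := N) (ctoB cv (cto_const _))) => M NM.
exact: dl.
Qed.

Lemma ev_cto c w t : nm w < t -> geo t c -> cto (psum c w) (ev c w).
Proof. by move=> wt [B cB]; have [] := ev_tail 0 wt cB. Qed.

Lemma ev_uniform c (s t : R) : 0 <= s < t -> geo t c -> forall eps, 0 < eps ->
  exists N0, forall N w, (N0 <= N)%N -> nm w <= s ->
    nm (ev c w - psum c w N) <= eps.
Proof.
move=> /andP[s0 st] [B cB] eps e0; have t0 := le_lt_trans s0 st.
have x01 : 0 <= s / t < 1 by rewrite divr_ge0 ?(ltW t0) //= ltr_pdivrMr ?mul1r.
have /andP[x0 x1] := x01.
have B0 : 0 <= B.
  by apply: le_trans (cB 0%N); rewrite mulr_ge0 ?nm_ge0 ?exprn_ge0 ?ltW.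
have D0 : 0 <= B / (1 - s / t) by rewrite divr_ge0 ?subr_ge0 ?(ltW x1).
have d0 : 0 < B / (1 - s / t) + 1 by rewrite ltr_wpDl.
have [N0 h0] := expr_small x01 (divr_gt0 e0 d0).
exists N0 => N w NN ws; have wt := le_lt_trans ws st.
have [_ h] := ev_tail N wt cB; apply: (le_trans h).
have wst : nm w / t <= s / t by rewrite ler_wpM2r // invr_ge0 ltW.
apply: (@le_trans _ _ ((B / (1 - s / t) + 1) * (s / t) ^+ N)); last first.
  by rewrite mulrC -ler_pdivlMr // h0.
have w0 : 0 <= nm w / t by rewrite divr_ge0 ?nm_ge0 ?ltW.
apply: ler_pM; rewrite ?exprn_ge0 ?divr_ge0 ?subr_ge0 ?nm_ge0 ?(ltW t0) //.
- exact: le_trans wst (ltW x1).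
- apply: ler_wpDr => //; apply: ler_wpM2l => //.
  by rewrite lef_pV2 ?posrE ?subr_gt0 ?lerB // (le_lt_trans wst).
- by rewrite lerXn2r ?nnegrE.
Qed.

Lemma psumZ a c w N : psum (fun n => a * c n) w N = a * psum c w N.
Proof. by rewrite /psum mulr_sumr; apply: eq_bigr => n _; rewrite mulrA. Qed.

Lemma psumD c e w N : psum (fun n => c n + e n) w N = psum c w N + psum e w N.
Proof. by rewrite /psum -big_split; apply: eq_bigr => n _; rewrite mulrDl. Qed.

Lemma evZ a c w t : nm w < t -> geo t c -> ev (fun n => a * c n) w = a * ev c w.
Proof.
move=> wt gc; have ga : geo t (fun n => a * c n).
  case: gc => B cB; exists (nm a * B) => n; rewrite nmM -mulrA.
  by rewrite ler_wpM2l ?nm_ge0.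
apply: (cto_unique (ev_cto wt ga)); have := ctoZ a (ev_cto wt gc).
by under eq_fun do rewrite -psumZ.
Qed.

Lemma geo_ext t c e : c =1 e -> geo t c -> geo t e.
Proof. by move=> ce [B cB]; exists B => n; rewrite -ce. Qed.

Lemma ev_ext c e w : c =1 e -> ev c w = ev e w.
Proof. by move=> /funext ->. Qed.

Lemma geoZ t a c : geo t c -> geo t (fun n => a * c n).
Proof.
case=> B cB; exists (nm a * B) => n; rewrite nmM -mulrA.
by rewrite ler_wpM2l ?nm_ge0.
Qed.

Lemma geoD t c e : 0 <= t -> geo t c -> geo t e -> geo t (fun n => c n + e n).
Proof.
move=> t0 [B cB] [E eE]; exists (B + E) => n.
apply: (@le_trans _ _ ((nm (c n) + nm (e n)) * t ^+ n)).
  by rewrite ler_wpM2r ?exprn_ge0 // nmD.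
by rewrite mulrDl lerD.
Qed.

Lemma geo_le s t c : 0 <= s <= t -> geo t c -> geo s c.
Proof.
move=> /andP[s0 st] [B cB]; exists B => n; apply: le_trans (cB n).
by rewrite ler_wpM2l ?nm_ge0 // lerXn2r // nnegrE // (le_trans s0).
Qed.

Lemma evD c e w t : nm w < t -> geo t c -> geo t e ->
  ev (fun n => c n + e n) w = ev c w + ev e w.
Proof.
move=> wt gc ge; have t0 := ltW (le_lt_trans (nm_ge0 w) wt).
apply: (cto_unique (ev_cto wt (geoD t0 gc ge))).
have := ctoD (ev_cto wt gc) (ev_cto wt ge).
by under eq_fun do rewrite -psumD.
Qed.

Definition smul a D c n : C := if (D <= n)%N then a * c (n - D)%N else 0.

Lemma geo_smul t a D c : 0 <= t -> geo t c -> geo t (smul a D c).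
Proof.
move=> t0 [B cB]; have B0 : 0 <= B.
  by apply: le_trans (cB 0%N); rewrite mulr_ge0 ?nm_ge0 ?exprn_ge0.
exists (nm a * t ^+ D * B) => n; rewrite /smul; case: leqP => Dn.
  rewrite -{2}(subnKC Dn) exprD nmM mulrACA.
  by rewrite ler_wpM2l // mulr_ge0 ?nm_ge0 ?exprn_ge0.
by rewrite nm0 mul0r !mulr_ge0 ?nm_ge0 ?exprn_ge0.
Qed.

Lemma psum_smul a D c w N : psum (smul a D c) w N = a * w ^+ D * psum c w (N - D).
Proof.
rewrite /psum /smul; case: (leqP D N) => DN.
  rewrite -(subnKC DN); move: (N - D)%N => M; rewrite addKn.
  rewrite big_split_ord /= big1 ?add0r => [|i _]; last first.
    by rewrite leqNgt ltn_ord mul0r.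
  rewrite mulr_sumr; apply: eq_bigr => i _.
  by rewrite leq_addr addKn exprD; ring.
have -> : (N - D = 0)%N by apply/eqP; rewrite subn_eq0 ltnW.
rewrite big_ord0 mulr0 big1 // => i _.
by rewrite leqNgt (ltn_trans (ltn_ord i)) ?mul0r.
Qed.

Lemma ev_smul a D c w t : nm w < t -> geo t c ->
  ev (smul a D c) w = a * w ^+ D * ev c w.
Proof.
move=> wt gc; have t0 := ltW (le_lt_trans (nm_ge0 w) wt).
apply: (cto_unique (ev_cto wt (geo_smul _ _ t0 gc))).
have := ctoZ (a * w ^+ D) (cto_sub D (ev_cto wt gc)).
by under eq_fun do rewrite -psum_smul.
Qed.

(* Coefficients of [c] times the polynomial [\sum_(i < D) q i w^i]. *)
Definition conv c q D n : C := \sum_(i < D) smul (q i) i c n.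

Lemma convS c q D : conv c q D.+1 = (fun n => conv c q D n + smul (q D) D c n).
Proof. by apply/funext => n; rewrite /conv big_ord_recr. Qed.

Lemma geo_conv t c q D : 0 <= t -> geo t c -> geo t (conv c q D).
Proof.
move=> t0 gc; elim: D => [|D IH]; last first.
  by rewrite convS; apply: geoD => //; exact: geo_smul.
by exists 0 => n; rewrite /conv big_ord0 nm0 mul0r.
Qed.

Lemma ev_zero w : ev (fun=> 0) w = 0.
Proof.
apply: (@cto_unique (psum (fun=> 0) w)).
  apply: (@ev_cto _ _ (nm w + 1)); first by rewrite ltrDl.
  by exists 0 => n; rewrite nm0 mul0r.
move=> eps /ltW e0; exists 0%N => N _; rewrite /psum big1 ?subrr ?nm0 // => i _.
by rewrite mul0r.
Qed.

Lemma ev_conv c q D w t : nm w < t -> geo t c ->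
  ev (conv c q D) w = psum q w D * ev c w.
Proof.
move=> wt gc; have t0 := ltW (le_lt_trans (nm_ge0 w) wt).
elim: D => [|D IH].
  rewrite /psum big_ord0 mul0r -[RHS](ev_zero w); apply: ev_ext => n.
  by rewrite /conv big_ord0.
rewrite convS (evD wt) ?IH ?(ev_smul _ _ wt) //; last 2 first.
- exact: geo_conv.
- exact: geo_smul.
by rewrite /psum big_ord_recr /= mulrDl.
Qed.

Definition trunc c D n : C := if (n < D)%N then c n else 0.

Lemma geo_trunc t c D : 0 <= t -> geo t (trunc c D).
Proof.
move=> t0; exists (\sum_(n < D) nm (c n) * t ^+ n) => n; rewrite /trunc.
have p0 (i : 'I_D) : 0 <= nm (c i) * t ^+ i by rewrite mulr_ge0 ?nm_ge0 ?exprn_ge0.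
case: ltnP => [nD|_]; last by rewrite nm0 mul0r sumr_ge0.
by rewrite (bigD1 (Ordinal nD)) //= lerDl sumr_ge0.
Qed.

Lemma ev_trunc c D w : ev (trunc c D) w = psum c w D.
Proof.
have wt : nm w < nm w + 1 by rewrite ltrDl.
have g := geo_trunc c D (le_trans (nm_ge0 w) (ltW wt)).
apply: (cto_unique (ev_cto wt g)).
move=> eps /ltW e0; exists D => N /subnKC <-; move: (N - D)%N => M.
rewrite {2}/psum big_split_ord /= [X in _ - (_ + X)]big1 => [|i _]; last first.
  by rewrite /trunc ltnNge leq_addr mul0r.
rewrite addr0 (_ : \sum_(i < D) _ = psum c w D) ?subrr ?nm0 //.
by apply: eq_bigr => i _; rewrite /trunc ltn_ord.
Qed.

End PowerSeries.

Opaque clim ev.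

(** * Domination on a circle *)

Section Parseval.
Variable R : realType.
Local Notation C := R[i].
Local Notation nm := (@Normc.normc R).
Implicit Types (u : nat -> C) (v w : C) (c e q : nat -> C).

Lemma ev_bounded c (s t : R) : 0 <= s < t -> geo t c ->
  exists2 A, 0 <= A & forall w, nm w <= s -> nm (ev c w) <= A.
Proof.
move=> st gc; have [N h] := ev_uniform st gc ltr01; have /andP[s0 _] := st.
exists (1 + \sum_(n < N) nm (c n) * s ^+ n).
  by rewrite addr_ge0 // sumr_ge0 // => n _; rewrite mulr_ge0 ?nm_ge0 ?exprn_ge0.
move=> w ws; apply: (le_trans (nm_dist_le _ (psum c w N))).
rewrite addrC lerD ?h // /psum; apply: (le_trans (nm_sum _ _ _)).
apply: ler_sum => n _; rewrite nmM nmX ler_wpM2l ?nm_ge0 //.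
by rewrite lerXn2r ?nnegrE ?nm_ge0.
Qed.

Lemma psum_parseval c (s : R) z N : 0 <= s -> N.-primitive_root z ->
  \sum_(j < N) nm (psum c (s%:C * z ^+ j) N) ^+ 2
  = N%:R * \sum_(n < N) (nm (c n) * s ^+ n) ^+ 2.
Proof.
move=> s0 zN; under [in RHS]eq_bigr => n _.
  rewrite -{1}(ger0_norm s0) -nm_real -nmX -nmM; over.
rewrite -(finite_parseval (fun n => c n * s%:C ^+ n) zN).
apply: eq_bigr => j _; congr (nm _ ^+ 2); apply: eq_bigr => n _.
by rewrite exprMn mulrA.
Qed.

(** Both series are truncated at order [N], and the discrete Parseval identity is applied at the [N]
    points [s z^j]; with as many points as coefficients it is exact. The truncations inherit the
    domination up to an error uniform on the circle. *)
Lemma parseval_dom c e (s t k E : R) : 0 <= s < t -> geo t c -> geo t e -> 0 <= k ->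
  (forall w, nm w = s -> nm (ev c w) <= k * nm (ev e w)) ->
  (forall N, \sum_(n < N) (nm (e n) * s ^+ n) ^+ 2 <= E) ->
  forall N, \sum_(n < N) (nm (c n) * s ^+ n) ^+ 2 <= k ^+ 2 * E.
Proof.
move=> st gc ge k0 dom eE N0; apply: le_eps => eps eps0; have /andP[s0 _] := st.
have [A A0 eA] := ev_bounded st ge.
(* For the moduli [P], [Q] of the truncations of [e], [c] one has [Q <= k P + (k + 1) d]; squaring,
   with [P <= A + 1] and [d <= 1], gives [Q^2 <= k^2 P^2 + d K]. *)
pose K := (k + 1) * (2 * (k * (A + 1)) + (k + 1)).
have K0 : 0 < K by rewrite mulr_gt0 ?ltr_wpDl // mulr_ge0 // mulr_ge0 // addr_ge0.
pose d := Num.min 1 (eps / K).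
have d0 : 0 < d by rewrite lt_min ltr01 divr_gt0.
have d1 : d <= 1 by rewrite ge_min lexx.
have dK : d * K <= eps by rewrite -ler_pdivlMr // ge_min lexx orbT.
have [N1 h1] := ev_uniform st gc d0; have [N2 h2] := ev_uniform st ge d0.
pose N := (maxn N0 (maxn N1 N2)).+1.
have N10 : (N1 <= N)%N by rewrite /N; lia.
have N20 : (N2 <= N)%N by rewrite /N; lia.
have NR : 0 < N%:R :> R by rewrite ltr0n.
have pt w : nm w = s -> nm (psum c w N) ^+ 2 <= k ^+ 2 * nm (psum e w N) ^+ 2 + d * K.
  move=> ws; have ws' : nm w <= s by rewrite ws.
  have hc := h1 _ _ N10 ws'; have he := h2 _ _ N20 ws'.
  have hcd := dom _ ws; have eAw := eA _ ws'.
  have hc' := nm_dist_le (psum c w N) (ev c w); rewrite nm_distC in hc'.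
  have he1 := nm_dist_le (ev e w) (psum e w N).
  have he2 := nm_dist_le (psum e w N) (ev e w); rewrite nm_distC in he2.
  have p0 := nm_ge0 (psum e w N); have q0 := nm_ge0 (psum c w N).
  set P := nm (psum e w N) in he1 he2 p0 *.
  set Q := nm (psum c w N) in hc' q0 *.
  have QP : Q <= k * P + (k + 1) * d.
    have : k * nm (ev e w) <= k * (P + d) by rewrite ler_wpM2l //; lra.
    lra.
  have PA : P <= A + 1 by lra.
  have kP : k * P <= k * (A + 1) by rewrite ler_wpM2l.
  apply: (@le_trans _ _ ((k * P + (k + 1) * d) ^+ 2)).
    by rewrite lerXn2r // nnegrE addr_ge0 // mulr_ge0 ?addr_ge0 // ltW.
  rewrite sqrrD exprMn -addrA lerD2l /K.
  have : d * (k + 1) * (k * P) <= d * (k + 1) * (k * (A + 1)).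
    by rewrite ler_wpM2l // mulr_ge0 ?addr_ge0 // ltW.
  have : (k + 1) ^+ 2 * d * d <= (k + 1) ^+ 2 * d * 1.
    by rewrite ler_wpM2l // mulr_ge0 ?sqr_ge0 // ltW.
  lra.
have [z zN] := @ex_prim_root R N (ltn0Sn _).
have nz j : nm (s%:C * z ^+ j) = s.
  rewrite nmM nmX nm_real ger0_norm //.
  suff -> : nm z = 1 by rewrite expr1n mulr1.
  apply: (pexpIrn (n := N)); rewrite ?nnegrE ?nm_ge0 ?ler01 //.
  by rewrite -nmX (prim_expr_order zN) nm1 expr1n.
apply: (@le_trans _ _ (\sum_(n < N) (nm (c n) * s ^+ n) ^+ 2)).
  have NN : (N0 <= N)%N by rewrite /N; lia.
  rewrite -(subnKC NN) big_split_ord /= lerDl sumr_ge0 // => i _.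
  exact: sqr_ge0.
rewrite -(ler_pM2l NR) -(psum_parseval _ s0 zN).
apply: (@le_trans _ _ (\sum_(j < N) (k ^+ 2 * nm (psum e (s%:C * z ^+ j) N) ^+ 2 + d * K))).
  by apply: ler_sum => j _; exact: pt.
rewrite big_split /= -mulr_sumr (psum_parseval _ s0 zN) sumr_const card_ord.
rewrite mulrCA -(mulr_natl (d * K)) -mulrDr ler_pM2l // lerD //.
by rewrite ler_wpM2l ?sqr_ge0.
Qed.

(** The difference is dominated by the zero series on the circle, so every term of its Parseval sum
    vanishes. *)
Lemma ev_inj c e (s t : R) : 0 < s < t -> geo t c -> geo t e ->
  (forall w, nm w = s -> ev c w = ev e w) -> c =1 e.
Proof.
move=> /andP[s0 st] gc ge ce n; have t0 := ltW (lt_trans s0 st).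
pose x n := c n + (-1) * e n.
have gx : geo t x by apply: geoD => //; exact: geoZ.
have st' : 0 <= s < t by rewrite ltW.
apply/eqP; rewrite -subr_eq0 -mulN1r -/(x n) -nm_eq0.
have g0 : geo t (fun=> 0 : C) by exists 0 => m; rewrite nm0 mul0r.
have := @parseval_dom x (fun=> 0) s t 1 0 st' gx g0 ler01 _ _ n.+1.
rewrite mulr0 => /(_ _ _)/wrap[w ws|N|].
- have wt : nm w < t by rewrite ws.
  by rewrite ev_zero nm0 mulr0 (evD wt) ?(evZ _ wt) ?ce ?mulN1r ?subrr ?nm0 //; exact: geoZ.
- by rewrite big1 // => i _; rewrite nm0 mul0r expr0n.
rewrite big_ord_recr /= => h0.
have h1 : (nm (x n) * s ^+ n) ^+ 2 <= 0.
  by apply: le_trans h0; rewrite lerDr sumr_ge0 // => i _; exact: sqr_ge0.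
have : (nm (x n) * s ^+ n) ^+ 2 == 0 by rewrite eq_le h1 sqr_ge0.
by rewrite expf_eq0 mulf_eq0 expf_eq0 (gt_eqF s0) andbF orbF.
Qed.

(* Multiplication by [c] is an l^2 contraction on polynomials. *)
Definition contr c := forall q D N,
  \sum_(n < N) nm (conv c q D n) ^+ 2 <= \sum_(i < D) nm (q i) ^+ 2.

(** Take [s = 1 - x]. By Bernoulli's inequality the factor costs at most [x M X], and [K] is chosen
    so that [x < 1] and this cost is at most [eps]. *)
Lemma le_expr_lim (X E : R) M : 0 <= X ->
  (forall s, 0 < s < 1 -> s ^+ M * X <= E) -> X <= E.
Proof.
move=> X0 h; apply: le_eps => eps e0.
pose K := M%:R * X + eps + 1.
have MX : 0 <= M%:R * X by rewrite mulr_ge0.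
have K0 : 0 < K by rewrite /K; lra.
pose x := eps / K.
have x0 : 0 < x by rewrite divr_gt0.
have x1 : x < 1 by rewrite ltr_pdivrMr // mul1r /K; lra.
have xM : x * (M%:R * X) <= eps.
  rewrite /x mulrAC ler_pdivrMr // ler_wpM2l ?(ltW e0) // /K; lra.
have := h (1 - x); rewrite subr_gt0 x1 ltrBlDr ltrDl x0 => /(_ isT) hx.
have bern : 1 - M%:R * x <= (1 - x) ^+ M.
  elim: (M) => [|m IH]; first by rewrite expr0 mul0r subr0.
  rewrite exprS; apply: (@le_trans _ _ ((1 - x) * (1 - m%:R * x))).
    rewrite -natr1; have : 0 <= m%:R * x * x by apply: mulr_ge0 (ltW x0); apply: mulr_ge0 (ltW x0).
    nra.
  by rewrite ler_wpM2l // subr_ge0 ltW.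
have : (1 - M%:R * x) * X <= (1 - x) ^+ M * X by rewrite ler_wpM2r.
move: xM hx; set a := (1 - x) ^+ M * X; lra.
Qed.

(** For fixed [N] the weights on the left cost at most a further factor [s ^+ (2 * N)]; like the
    permitted loss [s ^+ M], it disappears as [s] tends to 1. *)
Lemma contr_lim c M :
  (forall q D N s, 0 < s < 1 ->
    s ^+ M * \sum_(n < N) (nm (conv c q D n) * s ^+ n) ^+ 2
    <= \sum_(i < D) nm (q i) ^+ 2) -> contr c.
Proof.
move=> h q D N; apply: (@le_expr_lim _ _ (M + 2 * N)).
  by apply: sumr_ge0 => n _; exact: sqr_ge0.
move=> s s01; apply: le_trans (h q D N s s01); have /andP[s0 s1] := s01.
rewrite exprD -mulrA ler_wpM2l ?exprn_ge0 ?(ltW s0) // mulr_sumr.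
apply: ler_sum => n _; rewrite exprMn mulrC ler_wpM2l ?sqr_ge0 //.
rewrite -exprM ler_wiXn2l ?(ltW s0) ?(ltW s1) //.
by rewrite mulnC leq_mul2l ltnW.
Qed.

Lemma psum_sqr_trunc q D (s : R) N : 0 <= s <= 1 ->
  \sum_(n < N) (nm (trunc q D n) * s ^+ n) ^+ 2 <= \sum_(i < D) nm (q i) ^+ 2.
Proof.
move=> /andP[s0 s1].
apply: (@le_trans _ _ (\sum_(n < D + N) nm (trunc q D n) ^+ 2)).
  rewrite addnC big_split_ord /= -[leLHS]addr0 lerD //; last first.
    by apply: sumr_ge0 => n _; exact: sqr_ge0.
  apply: ler_sum => n _; rewrite exprMn ler_piMr ?sqr_ge0 //.
  by rewrite exprn_ile1 ?exprn_ge0 // exprn_ile1.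
rewrite big_split_ord /= [X in _ + X]big1 ?addr0 => [|n _].
  by apply: ler_sum => n _; rewrite /trunc ltn_ord.
by rewrite /trunc ltnNge leq_addr nm0 expr0n.
Qed.

Lemma contr_conv_le c q D N (s t k : R) : 0 < s < t -> s <= 1 -> 0 <= k -> geo t c ->
  (forall w, nm w = s -> nm (ev c w) <= k) ->
  \sum_(n < N) (nm (conv c q D n) * s ^+ n) ^+ 2
  <= k ^+ 2 * \sum_(i < D) nm (q i) ^+ 2.
Proof.
move=> /andP[s0 st] s1 k0 gc ck; have t0 := ltW (lt_trans s0 st).
apply: (@parseval_dom _ (trunc q D) s t); rewrite ?(ltW s0) //.
- exact: geo_conv.
- exact: geo_trunc.
- move=> w ws; have wt : nm w < t by rewrite ws.
  by rewrite (ev_conv _ _ wt) // ev_trunc nmM mulrC ler_wpM2r ?nm_ge0 ?ck.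
- by move=> N'; apply: psum_sqr_trunc; rewrite ltW.
Qed.

(** Meant for a series left after a power of the variable has been divided out of a bounded
    function. The bound [s^-L] on the circle replaces the Schwarz lemma, because it tends to 1. *)
Lemma contr_of_bound c L : (forall t, 0 < t < 1 -> geo t c) ->
  (forall s w, 0 < s < 1 -> nm w = s -> nm (ev c w) * s ^+ L <= 1) -> contr c.
Proof.
move=> gc cb; apply: (@contr_lim _ (2 * L)) => q D N s s01.
have /andP[s0 s1] := s01.
have t01 : s < (1 + s) / 2 < 1 by apply/andP; split; lra.
have /andP[st t1] := t01.
have gt : geo ((1 + s) / 2) c by apply: gc; rewrite (lt_trans s0).
have sL : 0 < s ^+ L by rewrite exprn_gt0.
have := @contr_conv_le c q D N s _ (s ^+ L)^-1 _ (ltW s1) _ gt.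
rewrite s0 st invr_ge0 (ltW sL) => /(_ isT isT) h.
have {h} : \sum_(n < N) (nm (conv c q D n) * s ^+ n) ^+ 2
    <= (s ^+ L)^-1 ^+ 2 * \sum_(i < D) nm (q i) ^+ 2.
  by apply: h => w ws; rewrite -[leRHS]mul1r ler_pdivlMr // (cb s).
rewrite exprVn -exprM -ler_pdivrMl ?invr_gt0 ?exprn_gt0 // invrK.
by rewrite mulnC.
Qed.

End Parseval.

(** * Carlson inequalities and the refined Bohr inequality *)

Section Carlson.
Variable R : realType.
Local Notation C := R[i].
Local Notation nm := (@Normc.normc R).
Implicit Types (c p : nat -> C).

(* The contraction property tested on the polynomial
   [1 + w^m \sum_(l < m') p l w^l]. *)
Lemma contr_test c p m m' : (0 < m)%N -> contr c ->
  \sum_(j < m) nm (c j) ^+ 2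
  + \sum_(k < m') nm (c (m + k)%N + \sum_(l < m' | (l <= k)%N) p l * c (k - l)%N) ^+ 2
  <= 1 + \sum_(l < m') nm (p l) ^+ 2.
Proof.
case: m => // m _ hc.
pose q i : C := if (i < m.+1)%N then (i == 0%N)%:R else p (i - m.+1)%N.
have qr l : q (m.+1 + l)%N = p l by rewrite /q ltnNge leq_addr addKn.
have cv j : conv c q (m.+1 + m') j =
    c j + \sum_(l < m') smul (p l) (m.+1 + l) c j.
  rewrite /conv big_split_ord big_ord_recl /= big1 ?addr0 => [|i _].
    rewrite {1}/smul /= {1}/q /= mul1r subn0; congr (_ + _).
    by apply: eq_bigr => i _; rewrite qr.
  by rewrite /smul /q /= /bump /= add1n ltnS ltn_ord mul0r if_same.
have := hc q (m.+1 + m')%N (m.+1 + m')%N.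
rewrite !big_split_ord; congr (_ <= _).
- congr (_ + _); apply: eq_bigr => j _; rewrite cv /=.
    rewrite big1 ?addr0 // => l _.
    by rewrite /smul leqNgt (leq_trans (ltn_ord j)) ?leq_addr.
  congr (nm (_ + _) ^+ 2); rewrite [RHS]big_mkcond; apply: eq_bigr => l _.
  by rewrite /smul leq_add2l subnDl.
- congr (_ + _); last by apply: eq_bigr => l _; rewrite /= qr.
  rewrite big_ord_recl big1 ?addr0 => [|i _]; last first.
    by rewrite (_ : q _ = 0) ?nm0 ?expr0n // /q /= /bump add1n ltnS ltn_ord.
  by rewrite [LHS]addr0 (_ : q _ = 1) // nm1 expr1n.
Qed.

Lemma sum_rev n (f : nat -> R) : \sum_(l < n) f (n.-1 - l)%N = \sum_(l < n) f l.
Proof.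
case: n => [|n]; first by rewrite !big_ord0.
rewrite (reindex_inj rev_ord_inj) /=; apply: eq_bigr => l _.
by rewrite subSS subKn // -ltnS.
Qed.

(** In [contr_test] the coefficients of index at most [n] give [S] on the left, and the squared norm
    of [p] gives [S] on the right. These cancel, and the last term leaves [(r + S)^2 <= 1]. *)
Lemma carlson_odd c n : contr c ->
  nm (c (n + n).+1) <= 1 - \sum_(j < n.+1) nm (c j) ^+ 2.
Proof.
move=> hc; have [u u1 cu] := unimodular_phase (c (n + n).+1).
set r := nm _ in cu *; set S := \sum_(j < _) _.
have S0 : 0 <= S by apply: sumr_ge0 => j _; exact: sqr_ge0.
have r0 : 0 <= r by exact: nm_ge0.
(* With this [p] the coefficient of index [2n+1] is [u (|c (2n+1)| + S)]. *)
pose p l := u * (c (n - l)%N)^*.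
have rev (f : nat -> R) : \sum_(l < n.+1) f (n - l)%N = \sum_(l < n.+1) f l.
  exact: (sum_rev n.+1).
have := contr_test p n.+1 (ltn0Sn n) hc; rewrite -/S.
have -> : \sum_(l < n.+1) nm (p l) ^+ 2 = S.
  rewrite /S -(rev (fun l => nm (c l) ^+ 2)); apply: eq_bigr => l _.
  by rewrite nmM u1 mul1r nm_conj.
rewrite big_ord_recr /= addSn cu.
have -> : \sum_(l < n.+1 | (l <= n)%N) p l * c (n - l)%N = u * S%:C.
  rewrite /S -(rev (fun l => nm (c l) ^+ 2)) rmorph_sum mulr_sumr.
  rewrite big_mkcond; apply: eq_bigr => l _; rewrite -ltnS ltn_ord.
  by rewrite /= -mul_conj /p; ring.
rewrite -mulrDr -raddfD nmM u1 mul1r nm_real real_normK ?num_real //.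
set T := \sum_(_ < n) _ => h.
have T0 : 0 <= T by apply: sumr_ge0 => j _; exact: sqr_ge0.
have h1 : (r + S) ^+ 2 <= 1 ^+ 2 by rewrite expr1n; lra.
by move: h1; rewrite ler_pXn2r ?nnegrE ?addr_ge0 //; lra.
Qed.

Lemma carlson_even c n : contr c -> (0 < n)%N ->
  nm (c (n + n)%N) <=
  1 - \sum_(j < n) nm (c j) ^+ 2 - nm (c n) ^+ 2 / (1 + nm (c 0%N)).
Proof.
move=> hc; case: n => // n _; have [u u1 cu] := unimodular_phase (c (n.+1 + n.+1)%N).
set r := nm _ in cu *; set S := \sum_(j < _) _.
have S0 : 0 <= S by apply: sumr_ge0 => j _; exact: sqr_ge0.
have r0 : 0 <= r by exact: nm_ge0.
set a := nm (c 0%N); have a0 : 0 <= a by exact: nm_ge0.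
set y := nm (c n.+1) ^+ 2; have y0 : 0 <= y by exact: sqr_ge0.
pose t := (1 + a)^-1; have t0 : 0 <= t by rewrite invr_ge0 addr_ge0.
have ta : 1 - t * a = t by rewrite /t; field; lra.
(* The extra weight [t] at [l = 0] recovers the term [|c n|^2 / (1 + |c 0|)]. *)
pose p l := if l is 0%N then u * (c n.+1)^* * t%:C else u * (c (n.+1 - l)%N)^*.
have rev (f : nat -> R) : \sum_(l < n.+1) f (n.+1 - l.+1)%N = \sum_(l < n.+1) f l.
  rewrite -(sum_rev n.+1); apply: eq_bigr => l _; congr f; lia.
have := contr_test p n.+2 (ltn0Sn n) hc; rewrite -/S.
have -> : \sum_(l < n.+2) nm (p l) ^+ 2 = t ^+ 2 * y + S.
  rewrite big_ord_recl /= !nmM u1 mul1r nm_conj nm_real exprMn real_normK ?num_real // mulrC.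
  congr (_ + _); rewrite /S -(rev (fun l => nm (c l) ^+ 2)).
  by apply: eq_bigr => l _; rewrite /p /= /bump /= add1n nmM u1 mul1r nm_conj.
rewrite big_ord_recl big_ord_recr /= /bump /= add1n addn0 cu.
have -> : \sum_(l < n.+2 | (l <= n.+1)%N) p l * c (n.+1 - l)%N = u * (t * y + S)%:C.
  rewrite (eq_bigl xpredT) => [|l]; last by rewrite -ltnS ltn_ord.
  rewrite big_ord_recl /= subn0 rmorphD mulrDr; congr (_ + _).
    by rewrite /y rmorphM /= -mul_conj; ring.
  rewrite /S -(rev (fun l => nm (c l) ^+ 2)) rmorph_sum mulr_sumr.
  apply: eq_bigr => l _; by rewrite /= /bump /= add1n -mul_conj; ring.
have -> : \sum_(l < n.+2 | (l <= 0)%N) p l * c (0 - l)%N = u * (c n.+1)^* * t%:C * c 0%N.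
  rewrite big_mkcond big_ord_recl /= big1 ?addr0 // => i _.
rewrite -mulrDr -raddfD nmM u1 mul1r nm_real real_normK ?num_real //.
set T := \sum_(_ < n) _; set X := nm (c n.+1 + _).
(* Since [1 - t * a = t], the coefficient of index [n.+1] keeps at least the fraction [t] of its
   modulus; this pays for the term [t ^+ 2 * y] in the norm of [p]. *)
have X0 : t ^+ 2 * y <= X ^+ 2.
  rewrite -exprMn lerXn2r ?nnegrE ?mulr_ge0 ?nm_ge0 //.
  have := nm_dist_le (c n.+1) (c n.+1 + u * (c n.+1)^* * t%:C * c 0%N).
  rewrite opprD addNKr nmN !nmM u1 nm_conj nm_real (ger0_norm t0) -/a -/X.
  rewrite -{2}ta; lra.
have T0 : 0 <= T by apply: sumr_ge0 => j _; exact: sqr_ge0.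
move=> h; have h1 : (r + (t * y + S)) ^+ 2 <= 1 ^+ 2 by rewrite expr1n; lra.
have : r + (t * y + S) <= 1.
  by move: h1; rewrite ler_pXn2r ?nnegrE ?ler01 // addr_ge0 // addr_ge0 // mulr_ge0.
rewrite -/t; lra.
Qed.

Lemma contr_sum_le1 c N : contr c -> \sum_(j < N) nm (c j) ^+ 2 <= 1.
Proof.
move=> hc; have := contr_test (fun=> 0) 0 (ltn0Sn N) hc; rewrite !big_ord0 !addr0.
by apply: le_trans; rewrite big_ord_recr lerDl sqr_ge0.
Qed.

Lemma contr_coef0 c : contr c -> nm (c 0%N) <= 1.
Proof.
move=> /(contr_sum_le1 1); rewrite big_ord1 -[leRHS](expr1n _ 2).
by rewrite ler_pXn2r ?nnegrE ?nm_ge0 ?ler01.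
Qed.

(** Carlson's inequalities with only the term [j = 0] of the sum kept. *)
Lemma contr_coef c n : contr c -> (0 < n)%N -> nm (c n) <= 1 - nm (c 0%N) ^+ 2.
Proof.
move=> hc n0; have /orP[od|ev] := orbN (odd n).
  have -> : n = (n./2 + n./2).+1 by rewrite -[LHS]odd_double_half od addnn.
  apply: (le_trans (carlson_odd _ hc)); rewrite lerD2l lerN2 big_ord_recl lerDl.
  by apply: sumr_ge0 => j _; exact: sqr_ge0.
have en : n = (n./2 + n./2)%N by rewrite -[LHS]odd_double_half (negbTE ev) addnn.
have n20 : (0 < n./2)%N by lia.
rewrite {1}en; apply: (le_trans (carlson_even hc n20)).
rewrite -addrA lerD2l -opprD lerN2 -(prednK n20) big_ord_recl -addrA lerDl addr_ge0 //.
  by apply: sumr_ge0 => j _; exact: sqr_ge0.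
by rewrite divr_ge0 ?sqr_ge0 // addr_ge0 ?nm_ge0.
Qed.

(** The value 1/3 is where [s / (1 - s)] reaches 1/2; then [a + (1 - a^2) / 2 <= 1] is
    [(1 - a)^2 >= 0]. *)
Lemma bohr_contr c (s : R) N : contr c -> 0 <= s <= 3^-1 ->
  \sum_(n < N) nm (c n) * s ^+ n <= 1.
Proof.
move=> hc /andP[s0 s3]; case: N => [|N]; first by rewrite big_ord0.
have a1 := contr_coef0 hc; have a0 := nm_ge0 (c 0%N).
set a := nm (c 0%N) in a1 a0.
rewrite big_ord_recl mulr1 -/a.
apply: (@le_trans _ _ (a + (1 - a ^+ 2) * s * \sum_(n < N) s ^+ n)).
  rewrite lerD2l mulr_sumr; apply: ler_sum => n _.
  rewrite /= /bump /= add1n exprS mulrA ler_wpM2r ?exprn_ge0 //.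
  by rewrite ler_wpM2r // contr_coef.
have s1 : s < 1 by apply: le_lt_trans s3 _; rewrite invf_lt1 ?ltr1n.
have g : s * \sum_(n < N) s ^+ n <= 2^-1.
  apply: (@le_trans _ _ (s * (1 - s)^-1)).
    by rewrite ler_wpM2l // geometric_le // s0.
  rewrite ler_pdivrMr ?subr_gt0 //; lra.
have : (1 - a ^+ 2) * (s * \sum_(n < N) s ^+ n) <= (1 - a ^+ 2) * 2^-1.
  by rewrite ler_wpM2l // subr_ge0 expr_le1.
have : 0 <= (1 - a) ^+ 2 by exact: sqr_ge0.
rewrite mulrA; lra.
Qed.

(* The last summand on the left is what makes the left side nonincreasing in
   [M]: it bounds the part of the geometric tails not yet used by Carlson's
   inequalities. *)
Lemma refined_bohr_step c (s : R) M : contr c -> 0 <= s < 1 ->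
  \sum_(n < M.+1.*2) nm (c n) * s ^+ n
  + ((1 + nm (c 0%N))^-1 + s / (1 - s)) * \sum_(n < M.+1) (nm (c n) * s ^+ n) ^+ 2
  + (1 - \sum_(n < M.+1) nm (c n) ^+ 2) * (s ^+ M.+1.*2 / (1 - s))
  <= nm (c 0%N) + ((1 + nm (c 0%N))^-1 + s / (1 - s)) * nm (c 0%N) ^+ 2
     + (1 - nm (c 0%N) ^+ 2) * (s / (1 - s)).
Proof.
move=> hc /andP[s0 s1]; set a := nm (c 0%N); set K := _^-1 + _.
have d0 : 0 < 1 - s by rewrite subr_gt0.
have dn : 1 - s != 0 by rewrite gt_eqF.
have a0 : 0 <= a by exact: nm_ge0.
elim: M => [|M IH].
  rewrite !big_ord_recl !big_ord0 /= -/a !addr0 !mulr1 expr1 -!addrA lerD2l.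
  have h1 := contr_coef hc (ltn0Sn 0).
  have {h1} : nm (c 1%N) * s <= (1 - a ^+ 2) * s by rewrite ler_wpM2r.
  have -> : (1 - a ^+ 2) * (s / (1 - s)) =
    (1 - a ^+ 2) * s + (1 - a ^+ 2) * (s ^+ 2 / (1 - s)) by field.
  rewrite /bump /=; lra.
apply: le_trans IH; move: (ltn0Sn M); move: M.+1 => m m0.
rewrite doubleS 2!big_ord_recr /= big_ord_recr /=.
rewrite [\sum_(n < m.+1) nm (c n) ^+ 2]big_ord_recr /=.
have ho := carlson_odd m hc; have he := carlson_even hc m0.
rewrite addnn -/a in he; rewrite addnn big_ord_recr /= in ho.
set S := \sum_(n < m) nm (c n) ^+ 2 in ho he *.
set X := \sum_(n < m.*2) _; set Y := \sum_(n < m) _.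
set y := nm (c m) ^+ 2 in ho he *.
set xo := nm (c m.*2.+1) in ho *; set xe := nm (c m.*2) in he *.
have -> : (nm (c m) * s ^+ m) ^+ 2 = y * s ^+ m.*2.
  by rewrite exprMn -exprM muln2.
have Q0 : 0 <= s ^+ m.*2 by rewrite exprn_ge0.
rewrite !exprS; set Q := s ^+ m.*2 in Q0 *.
set iv := (1 + a)^-1 in he K *.
have h1 : Q * xe <= Q * (1 - S - y * iv) by rewrite ler_wpM2l.
have h2 : Q * s * xo <= Q * s * (1 - (S + y)) by rewrite ler_wpM2l ?mulr_ge0.
(* The weight [K = iv + s / (1 - s)] is exactly the one for which [y] cancels: the even inequality
   uses [iv], while the odd one and the tail use [s + s^2 / (1 - s) = s / (1 - s)]. *)
have e : Q * (1 - S - y * iv) + Q * s * (1 - (S + y)) + K * (y * Q)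
  + (1 - (S + y)) * (s * (s * Q) / (1 - s)) = (1 - S) * (Q / (1 - s)).
  by rewrite /K; field.
rewrite /K in e *; lra.
Qed.

(** The right side of [refined_bohr_step] simplifies to [a + a^2 / (1 + a) + s / (1 - s)], which
    increases with [a]; the value 3/2 comes from [a = 1]. *)
Lemma refined_bohr c (s : R) N : contr c -> 0 <= s < 1 ->
  \sum_(n < N) nm (c n) * s ^+ n
  + ((1 + nm (c 0%N))^-1 + s / (1 - s)) * \sum_(n < N) (nm (c n) * s ^+ n) ^+ 2
  <= 3 / 2 + s / (1 - s).
Proof.
move=> hc s01; have /andP[s0 s1] := s01; have d0 : 0 < 1 - s by rewrite subr_gt0.
have := refined_bohr_step N hc s01.
have a1 := contr_coef0 hc; have a0 := nm_ge0 (c 0%N).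
set a := nm (c 0%N) in a1 a0 *; set K := _ + s / (1 - s).
have K0 : 0 <= K by rewrite addr_ge0 ?invr_ge0 ?addr_ge0 ?divr_ge0 ?(ltW d0).
have T0 : 0 <= (1 - \sum_(n < N.+1) nm (c n) ^+ 2) * (s ^+ N.+1.*2 / (1 - s)).
  rewrite mulr_ge0 ?divr_ge0 ?exprn_ge0 ?(ltW d0) // subr_ge0.
  exact: contr_sum_le1.
have XX : \sum_(n < N) nm (c n) * s ^+ n <= \sum_(n < N.+1.*2) nm (c n) * s ^+ n.
  have NN : (N <= N.+1.*2)%N by lia.
  rewrite -(subnKC NN) big_split_ord lerDl sumr_ge0 // => i _.
  by rewrite mulr_ge0 ?nm_ge0 ?exprn_ge0.
have YY : K * \sum_(n < N) (nm (c n) * s ^+ n) ^+ 2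
    <= K * \sum_(n < N.+1) (nm (c n) * s ^+ n) ^+ 2.
  by rewrite ler_wpM2l // big_ord_recr lerDl sqr_ge0.
have : a + K * a ^+ 2 + (1 - a ^+ 2) * (s / (1 - s)) <= 3 / 2 + s / (1 - s).
  have -> : K * a ^+ 2 = a ^+ 2 / (1 + a) + a ^+ 2 * (s / (1 - s)).
    by rewrite /K mulrDl mulrC [s / _ * _]mulrC.
  have : a ^+ 2 / (1 + a) <= 2^-1.
    by rewrite ler_pdivrMr ?ltr_wpDr //; nra.
  lra.
lra.
Qed.

End Carlson.

(** * Linear factors of power series *)

Section Quotient.
Variable R : realType.
Local Notation C := R[i].
Local Notation nm := (@Normc.normc R).
Implicit Types (c e q : nat -> C) (w v : C).

Lemma geo_sum c (s t : R) : 0 <= s < t -> geo t c ->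
  exists2 A, 0 <= A & forall N, \sum_(n < N) nm (c n) * s ^+ n <= A.
Proof.
move=> /andP[s0 st] [B cB]; have t0 := le_lt_trans s0 st.
have x01 : 0 <= s / t < 1 by rewrite divr_ge0 ?(ltW t0) //= ltr_pdivrMr ?mul1r.
have B0 : 0 <= B.
  by apply: le_trans (cB 0%N); rewrite mulr_ge0 ?nm_ge0 // exprn_ge0 // ltW.
exists (B / (1 - s / t)).
  by case/andP: x01 => _ x1; rewrite divr_ge0 ?subr_ge0 ?(ltW x1).
move=> N; apply: (@le_trans _ _ (B * \sum_(n < N) (s / t) ^+ n)).
  rewrite mulr_sumr; apply: ler_sum => n _.
  rewrite -{1}(ger0_norm s0) -nm_real; apply: le_trans (ratio_bound _ _ t0 cB) _.
  by rewrite nm_real ger0_norm.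
by rewrite ler_wpM2l // geometric_le.
Qed.

Lemma geo_deriv c (s t : R) : 0 <= s < t -> geo t c -> geo s (fun n => n%:R * c n).
Proof.
move=> /andP[s0 st] [B cB]; have t0 := le_lt_trans s0 st.
have x01 : 0 <= s / t < 1 by rewrite divr_ge0 ?(ltW t0) //= ltr_pdivrMr ?mul1r.
have /andP[x0 x1] := x01.
have B0 : 0 <= B.
  by apply: le_trans (cB 0%N); rewrite mulr_ge0 ?nm_ge0 // exprn_ge0 // ltW.
exists (B / (1 - s / t)) => n.
rewrite nmM nm_nat -mulrA -{1}(ger0_norm s0) -nm_real.
apply: (@le_trans _ _ (n%:R * (B * (s / t) ^+ n))).
  rewrite ler_wpM2l //; apply: le_trans (ratio_bound _ _ t0 cB) _.
  by rewrite nm_real ger0_norm.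
(* For [0 <= x < 1], [n x^n] is at most the sum of the first [n] powers of [x]. *)
rewrite mulrCA ler_wpM2l //; apply: le_trans (geometric_le n x01).
rewrite mulr_natl -{2}[n]card_ord -sumr_const; apply: ler_sum => i _.
by rewrite ler_wiXn2l ?(ltW x1) // ltnW.
Qed.

(** The usual bound [n s^(n-1) |w - v|], multiplied by [s] so that no truncated exponent occurs at
    [n = 0]. *)
Lemma expr_lip w v (s : R) n : nm w <= s -> nm v <= s ->
  nm (w ^+ n - v ^+ n) * s <= n%:R * s ^+ n * nm (w - v).
Proof.
move=> ws vs; have s0 := le_trans (nm_ge0 w) ws.
elim: n => [|n IH]; first by rewrite subrr nm0 !mul0r.
have -> : w ^+ n.+1 - v ^+ n.+1 = w * (w ^+ n - v ^+ n) + (w - v) * v ^+ n.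
  by rewrite !exprS; ring.
apply: (@le_trans _ _ (s * (n%:R * s ^+ n * nm (w - v)) + nm (w - v) * s ^+ n * s)).
  apply: (@le_trans _ _ (nm w * nm (w ^+ n - v ^+ n) * s + nm (w - v) * nm v ^+ n * s)).
    by rewrite -mulrDl ler_wpM2r // (le_trans (nmD _ _)) // !nmM nmX.
  rewrite lerD //.
    by rewrite -mulrA ler_pM ?nm_ge0 // mulr_ge0 ?nm_ge0.
  by rewrite ler_wpM2r // ler_wpM2l ?nm_ge0 // lerXn2r // nnegrE nm_ge0.
by rewrite -[n.+1%:R]natr1 exprS le_eqVlt; apply/orP; left; apply/eqP; ring.
Qed.

Lemma ev_lip c (s t : R) : 0 < s < t -> geo t c -> exists2 A, 0 <= A &
  forall w v, nm w <= s -> nm v <= s -> nm (ev c w - ev c v) <= A * nm (w - v).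
Proof.
move=> /andP[s0 st] gc; pose s1 := (s + t) / 2.
have s1t : 0 <= s1 < t by rewrite /s1; apply/andP; split; lra.
have ss1 : 0 <= s < s1 by rewrite /s1; apply/andP; split; lra.
have [A A0 hA] := geo_sum ss1 (geo_deriv s1t gc).
exists (A / s); first by rewrite divr_ge0 ?(ltW s0).
move=> w v ws vs; have wt := le_lt_trans ws st; have vt := le_lt_trans vs st.
apply: (cto_le (N1 := 0) (ctoB (ev_cto wt gc) (ev_cto vt gc))) => N _.
rewrite mulrAC ler_pdivlMr //.
have -> : psum c w N - psum c v N = \sum_(n < N) c n * (w ^+ n - v ^+ n).
  by rewrite /psum -sumrB; apply: eq_bigr => n _; rewrite mulrBr.
apply: (@le_trans _ _ (\sum_(n < N) nm (c n) * (n%:R * s ^+ n * nm (w - v)))).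
  apply: le_trans (ler_wpM2r (ltW s0) (nm_sum _ _ _)) _.
  rewrite mulr_suml; apply: ler_sum => n _; rewrite nmM -[leLHS]mulrA.
  by rewrite ler_wpM2l ?nm_ge0 // expr_lip.
apply: le_trans (ler_wpM2r (nm_ge0 _) (hA N)); rewrite mulr_suml.
by apply: ler_sum => n _; rewrite nmM nm_nat le_eqVlt; apply/orP; left; apply/eqP; ring.
Qed.

(** Lipschitz continuity fills in the point [z], which is lost whenever a factor vanishing there has
    been cancelled from both sides. *)
Lemma dom_fill c e z (t : R) : 0 < t -> geo t c -> geo t e ->
  (forall w, w != z -> nm w < t -> nm (ev c w) <= nm (ev e w)) ->
  forall w, nm w < t -> nm (ev c w) <= nm (ev e w).
Proof.
move=> t0 gc ge h w wt; have [wz|] := eqVneq w z; last by move=> ?; exact: h.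
pose s := (nm w + t) / 2; have w0 := nm_ge0 w.
have st : 0 < s < t by rewrite /s; apply/andP; split; lra.
have ws : nm w < s by rewrite /s; lra.
have [A A0 hA] := ev_lip st gc; have [B B0 hB] := ev_lip st ge.
apply: le_eps => eps eps0.
have K0 : 0 < A + B + 1 by rewrite ltr_wpDl // addr_ge0.
pose d := Num.min (s - nm w) (eps / (A + B + 1)).
have d0 : 0 < d by rewrite lt_min subr_gt0 ws divr_gt0.
have ds : d <= s - nm w by rewrite ge_min lexx.
have dK : d * (A + B + 1) <= eps by rewrite -ler_pdivlMr // ge_min lexx orbT.
pose x := w + d%:C; have xw : nm (w - x) = d.
  by rewrite /x opprD addNKr nmN nm_real gtr0_norm.
have xs : nm x <= s.
  by apply: le_trans (nmD _ _) _; rewrite nm_real gtr0_norm //; lra.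
have xz : x != z.
  by rewrite -wz /x -subr_eq0 addrAC subrr add0r -nm_gt0 nm_real gtr0_norm.
have key (a b a' b' e1 e2 : R) : a' <= b' -> a <= a' + e1 -> b' <= b + e2 ->
  e1 <= A * d -> e2 <= B * d -> a <= b + eps by lra.
apply: (key _ _ _ _ _ _ (h _ xz (le_lt_trans xs (andP st).2)) (nm_dist_le _ _)
  (nm_dist_le' _ _)); rewrite -xw; [exact: hA (ltW ws) xs|exact: hB (ltW ws) xs].
Qed.

Definition lin a b c n : C := a * c n + b * (if n is m.+1 then c m else 0).

Lemma lin_smul a b c n : lin a b c n = smul a 0 c n + smul b 1 c n.
Proof. by case: n => [|n]; rewrite /lin /smul /= ?mulr0 ?subn0 ?subn1. Qed.

Lemma geo_lin t a b c : 0 <= t -> geo t c -> geo t (lin a b c).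
Proof.
move=> t0 gc; apply: (@geo_ext _ _ (fun n => smul a 0 c n + smul b 1 c n)).
  by move=> n; rewrite lin_smul.
by apply: geoD => //; exact: geo_smul.
Qed.

Lemma ev_lin a b c w t : nm w < t -> geo t c -> ev (lin a b c) w = (a + b * w) * ev c w.
Proof.
move=> wt gc; have t0 := ltW (le_lt_trans (nm_ge0 w) wt).
rewrite (ev_ext _ (lin_smul a b c)) (evD wt) ?(ev_smul _ _ wt) //; last 2 first.
- exact: geo_smul.
- exact: geo_smul.
by rewrite expr0 expr1; ring.
Qed.

Lemma lin_inj a b c e : a != 0 -> lin a b c =1 lin a b e -> c =1 e.
Proof.
move=> a0 h n; elim: n => [|n IH].
  by have := h 0%N; rewrite /lin mulr0 !addr0 => /(mulfI a0).
by have := h n.+1; rewrite /lin IH => /addIr /(mulfI a0).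
Qed.

(* The quotient of [e] by [w - r]; its radius does not shrink if [r] is outside
   the disc, or is a zero of [e]. *)
Definition divlin r e n : C := - psum e r n.+1 / r ^+ n.+1.

Lemma divlinK r e : r != 0 -> lin (- r) 1 (divlin r e) =1 e.
Proof.
move=> r0 [|n]; rewrite /lin /divlin /psum.
  by rewrite big_ord1 expr0 expr1; field.
rewrite big_ord_recr /= [r ^+ n.+2]exprS.
by have rn : r ^+ n.+1 != 0; [exact: expf_neq0 | field; rewrite r0 rn].
Qed.

(** The terms [e i * r ^+ i] are at most a multiple of [(nm r / s) ^+ i], a growing geometric
    sequence, so the partial sum is comparable with its last bound. The reversed sum has ratio
    [s / nm r < 1]. *)
Lemma geo_divlin_out r e (s : R) : 0 < s < nm r -> geo s e -> geo s (divlin r e).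
Proof.
move=> /andP[s0 sr] [B eB]; have r0 := lt_trans s0 sr.
have x01 : 0 <= s / nm r < 1.
  by rewrite divr_ge0 ?(ltW s0) ?nm_ge0 //= ltr_pdivrMr ?mul1r.
have B0 : 0 <= B.
  by apply: le_trans (eB 0%N); rewrite mulr_ge0 ?nm_ge0 // exprn_ge0 // ltW.
exists (B / (1 - s / nm r) / nm r) => n.
rewrite /divlin nmM nmN nmV nmX mulrAC ler_pdivrMr ?exprn_gt0 //.
rewrite exprS mulrA divfK ?gt_eqF //.
apply: (@le_trans _ _ (\sum_(i < n.+1) nm (e i) * nm r ^+ i * s ^+ n)).
  rewrite -mulr_suml ler_wpM2r ?exprn_ge0 ?(ltW s0) //.
  by apply: le_trans (nm_sum _ _ _) _; apply: ler_sum => i _; rewrite nmM nmX.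
rewrite mulrAC; apply: le_trans (ler_wpM2l _ (geometric_le n.+1 x01)); last first.
  by rewrite mulr_ge0 ?exprn_ge0 ?(ltW r0).
rewrite [in leRHS](reindex_inj rev_ord_inj) mulr_sumr; apply: ler_sum => i _ /=.
have iN : (i <= n)%N by rewrite -ltnS.
have xn (x : R) : x ^+ n = x ^+ i * x ^+ (n - i) by rewrite -exprD subnKC.
rewrite subSS !xn expr_div_n.
have rn : nm r ^+ (n - i) != 0 by rewrite expf_neq0 // gt_eqF.
have -> : B * (nm r ^+ i * nm r ^+ (n - i)) * (s ^+ (n - i) / nm r ^+ (n - i))
  = B * (nm r ^+ i * s ^+ (n - i)) by field.
have -> : nm (e i) * nm r ^+ i * (s ^+ i * s ^+ (n - i))
  = nm (e i) * s ^+ i * (nm r ^+ i * s ^+ (n - i)) by ring.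
by rewrite ler_wpM2r // mulr_ge0 // exprn_ge0 // ltW.
Qed.

(** At a zero the partial sum in [divlin] is minus the tail of the series, of order
    [(nm r / t) ^+ n.+1]; division by [r ^+ n.+1] leaves [t ^- n.+1]. *)
Lemma geo_divlin_zero r e (t : R) : r != 0 -> nm r < t -> geo t e -> ev e r = 0 ->
  geo t (divlin r e).
Proof.
move=> r0 rt [B eB] er; have t0 := le_lt_trans (nm_ge0 r) rt.
have rn : 0 < nm r by rewrite nm_gt0.
exists (B / (1 - nm r / t) / t) => n.
have [_] := ev_tail n.+1 rt eB; rewrite er sub0r nmN => h.
rewrite /divlin nmM nmN nmV nmX mulrAC ler_pdivrMr ?exprn_gt0 //.
apply: le_trans (ler_wpM2r (exprn_ge0 _ (ltW t0)) h) _.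
rewrite le_eqVlt; apply/orP; left; apply/eqP; rewrite expr_div_n [t ^+ n.+1]exprS.
set K := B / _; have tn : t ^+ n != 0 by rewrite expf_neq0 // gt_eqF.
by field; rewrite tn gt_eqF.
Qed.

Lemma div_roots (rs : seq C) e (s : R) : 0 < s -> all (fun r => s < nm r) rs ->
  geo s e -> exists2 c, geo s c &
    forall w, nm w < s -> (\prod_(r <- rs) (w - r)) * ev c w = ev e w.
Proof.
move=> s0; elim: rs e => [|r rs IH] e /= => [_|/andP[sr hrs]] ge.
  by exists e => // w _; rewrite big_nil mul1r.
have sr' : 0 < s < nm r by rewrite s0.
have [c gc hc] := IH _ hrs (geo_divlin_out sr' ge).
exists c => // w ws; rewrite big_cons -mulrA hc //.
have r0 : r != 0 by rewrite -nm_gt0 (lt_trans s0).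
rewrite -[RHS](ev_ext _ (divlinK e r0)) (ev_lin _ _ ws) ?mul1r 1?addrC //.
exact: geo_divlin_out.
Qed.

End Quotient.

(** * Minimum modulus on a disc *)

Section Zeros.
Variable R : realType.
Local Notation C := R[i].
Local Notation nm := (@Normc.normc R).
Implicit Types (c e q : nat -> C) (w v : C).

(** Complex numbers are read as real pairs, so that a closed disc is a closed subset of a product of
    two segments. *)
Local Notation toC := (fun z : R * R => z.1 +i* z.2 : C).

Lemma nm_lip_pair (x y : R * R) (d : R) :
  ball x d y -> nm (toC x - toC y) <= d + d.
Proof.
case=> h1 h2; apply: le_trans (nm_ReIm _) _; rewrite !raddfB /=.
by rewrite lerD // ltW.
Qed.

Lemma within_continuous_lip (A : set (R * R)) (f : C -> R) (L : R) :
  0 <= L -> (forall x y, A x -> A y -> `|f (toC x) - f (toC y)| <= L * nm (toC x - toC y)) ->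
  {within A, continuous (fun z => f (toC z))}.
Proof.
move=> L0 fL; apply/subspace_continuousP => x Ax.
apply/cvgrPdist_le => eps eps0.
have K0 : 0 < 2 * L + 1 by lra.
rewrite near_withinE; apply/nbhs_ballP; exists (eps / (2 * L + 1)) => /=.
  by rewrite divr_gt0.
move=> y /nm_lip_pair xy Ay; apply: (le_trans (fL _ _ Ax Ay)).
set d := eps / _ in xy *; have dK : d * (2 * L + 1) = eps by rewrite divfK // gt_eqF.
have d0 : 0 < d by rewrite divr_gt0.
apply: (le_trans (ler_wpM2l L0 xy)); lra.
Qed.

Lemma compact_disc (s : R) : 0 <= s -> compact [set z : R * R | nm (toC z) <= s].
Proof.
move=> s0; apply: (@subclosed_compact _ _ (`[- s, s] `*` `[- s, s])).
- have cont : continuous (fun z : R * R => nm (toC z)).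
    move=> x; have /subspace_continuousP/(_ x I) : {within setT, continuous (fun z : R * R => nm (toC z))}.
      apply: (@within_continuous_lip _ nm 1) => // u v _ _; rewrite mul1r.
      rewrite ler_norml lerBlDl nm_dist_le andbT lerBrDl -lerBrDr opprK.
      exact: nm_dist_le'.
    by rewrite withinET.
  apply: (@preimage_closed _ _ (fun z : R * R => nm (toC z)) [set x | x <= s]).
    by move=> z _; exact: cont.
  exact: closed_le.
- by apply: compact_setX; exact: segment_compact.
- move=> [a b] /= h; split => /=; rewrite in_itv /= -ler_norml.
    exact: le_trans (nm_Re _) h.
  exact: le_trans (nm_Im _) h.
Qed.

Lemma ev_min e (s t : R) : 0 < s < t -> geo t e ->
  (forall w, nm w <= s -> ev e w != 0) ->
  exists2 d : R, 0 < d & forall w, nm w <= s -> d <= nm (ev e w).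
Proof.
move=> st ge ez; have /andP[s0 _] := st.
have [A A0 hA] := ev_lip st ge.
have [||c] := @compact_EVT_min _ R (fun z => nm (ev e (toC z))) _ _ (compact_disc (ltW s0)).
- by exists (0, 0) => /=; rewrite (_ : 0 +i* 0 = 0) ?nm0 // ltW.
- apply: (@within_continuous_lip _ (fun w => nm (ev e w)) _ A0) => x y hx hy.
  apply: le_trans (hA _ _ hx hy).
  rewrite ler_norml lerBlDl nm_dist_le andbT lerBrDl -lerBrDr opprK.
  exact: nm_dist_le'.
rewrite inE /= => hc hmin; exists (nm (ev e (toC c))).
  by rewrite nm_gt0 ez.
by move=> [a b] hw; apply: (hmin (a, b)); rewrite inE.
Qed.
End Zeros.

(** * Quotients of dominated power series *)

Section Quotient.
Variable R : realType.
Local Notation C := R[i].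
Local Notation nm := (@Normc.normc R).
Implicit Types (c e q G H om : nat -> C) (w v : C).

Definition cauchy_prod q c n : C := \sum_(i < n.+1) q i * c (n - i)%N.

Lemma conv_cauchy c q D n : (n < D)%N -> conv c q D n = cauchy_prod q c n.
Proof.
move=> nD; rewrite /conv /cauchy_prod -(subnKC nD) big_split_ord /=.
rewrite [X in _ + X]big1 ?addr0 => [|i _]; last first.
  by rewrite /smul leqNgt addSn ltnS leq_addr.
by apply: eq_bigr => i _; rewrite /smul -ltnS ltn_ord.
Qed.

Lemma eq_conv c e q D n : (forall m, (m <= n)%N -> c m = e m) ->
  conv c q D n = conv e q D n.
Proof.
move=> ce; apply: eq_bigr => i _; rewrite /smul; case: leqP => // _.
by rewrite ce // leq_subr.
Qed.

Lemma cauchy_prod_inj q c e M : q 0%N != 0 ->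
  (forall n, (n < M)%N -> cauchy_prod q c n = cauchy_prod q e n) ->
  forall n, (n < M)%N -> c n = e n.
Proof.
move=> q0 h n; elim/ltn_ind: n => n IH nM.
have := h n nM; rewrite /cauchy_prod !big_ord_recl /= subn0.
have -> : \sum_(i < n) q (bump 0 i) * c (n - bump 0 i)%N
        = \sum_(i < n) q (bump 0 i) * e (n - bump 0 i)%N.
  apply: eq_bigr => i _; rewrite IH //; have := ltn_ord i; rewrite /bump /=; lia.
by move=> /addIr /(mulfI q0).
Qed.

Lemma cauchy_prod_lin a b q c : cauchy_prod (lin a b q) c =1 lin a b (cauchy_prod q c).
Proof.
move=> n; rewrite /cauchy_prod /lin mulr_sumr.
under eq_bigr do rewrite mulrDl -!mulrA.
rewrite big_split /=; congr (_ + _); rewrite -mulr_sumr; congr (_ * _).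
by case: n => [|n]; rewrite big_ord_recl /= mul0r ?big_ord0 ?add0r.
Qed.

(** Formal division, with no claim of convergence: [next] solves the equation of index [size s] for
    the next coefficient, and [os n] lists the first [n] of them. *)
Lemma ex_cauchy_quotient q e : q 0%N != 0 -> exists c, e =1 cauchy_prod q c.
Proof.
move=> q0.
pose next (s : seq C) :=
  (e (size s) - \sum_(i < size s) q i.+1 * s`_(size s - i.+1)) / q 0%N.
pose os := fix F n := if n is m.+1 then rcons (F m) (next (F m)) else [::].
have sz n : size (os n) = n by elim: n => //= n IH; rewrite size_rcons IH.
have nthE n m : (m < n)%N -> (os n)`_m = next (os m).
  elim: n => //= n IH; rewrite ltnS leq_eqVlt => /orP[/eqP ->|mn].
    by rewrite nth_rcons sz ltnn eqxx.
  by rewrite nth_rcons sz mn IH.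
exists (fun n => next (os n)) => n; rewrite /cauchy_prod big_ord_recl subn0.
rewrite {1}/next sz mulrC divfK // -[LHS](subrK (\sum_(i < n) q i.+1 * (os n)`_(n - i.+1))).
congr (_ + _); apply: eq_bigr => i _; rewrite /= /bump /= add1n; congr (_ * _).
by rewrite nthE //; have := ltn_ord i; lia.
Qed.

(* What [|om| <= 1] on the disc of radius [s] gives, with a loss [k > 1]. *)
Definition semicontr (s : R) om := forall (s2 k : R) q D N, 0 < s2 < s -> 1 < k ->
  \sum_(n < N) (nm (conv om q D n) * s2 ^+ n) ^+ 2
  <= k ^+ 2 * \sum_(i < D) nm (q i) ^+ 2.

(** A long truncation [P] of [H] has no zero in the disc, so the truncation of [G] can be divided by
    the linear factors of [P]. The quotient [c] is bounded by [k] on the disc, and its first [M]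
    coefficients are those of [om]. *)
Lemma zero_free_quotient G H om (s t d : R) : 0 < s < t -> s <= 1 -> 0 < d ->
  geo t G -> geo t H ->
  (forall w, nm w < t -> nm (ev G w) <= nm (ev H w)) ->
  (forall w, nm w <= s -> d <= nm (ev H w)) -> H 0%N != 0 ->
  G =1 cauchy_prod H om -> semicontr s om.
Proof.
move=> /andP[s0 st] s1 d0 gG gH dom Hd H0 GH s2 k q D N /andP[s20 s2s] k1.
have st' : 0 <= s < t by rewrite ltW.
(* The first bound keeps [P] at least [d / 2] in modulus. The second turns the total error [2 eps]
   into at most [(k - 1)] times that modulus. *)
pose eps := Num.min (d / 2) ((k - 1) * d / 4).
have k10 : 0 < k - 1 by rewrite subr_gt0.
have eps0 : 0 < eps by rewrite lt_min !divr_gt0 // mulr_gt0.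
have eps1 : eps <= d / 2 by rewrite ge_min lexx.
have eps2 : eps <= (k - 1) * d / 4 by rewrite ge_min lexx orbT.
have [N1 h1] := ev_uniform st' gG eps0; have [N2 h2] := ev_uniform st' gH eps0.
pose M := (N + N1 + N2).+1.
have NM1 : (N1 <= M)%N by rewrite /M; clear; lia.
have NM2 : (N2 <= M)%N by rewrite /M; clear; lia.
have key (a b a' b' : R) : d <= b' -> a' <= b' -> b' <= b + eps -> a <= a' + eps ->
    a <= k * b /\ 0 < b.
  move=> p1 p2 p3 p4; have hb : d / 2 <= b by lra.
  split; last by lra.
  have : (k - 1) * (d / 2) <= (k - 1) * b by rewrite ler_wpM2l // ltW.
  lra.
have GH' w : nm w <= s -> nm (psum G w M) <= k * nm (psum H w M) /\ 0 < nm (psum H w M).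
  move=> ws; have wt := le_lt_trans ws st.
  apply: (key _ _ _ _ (Hd _ ws) (dom _ wt)).
    exact: le_trans (nm_dist_le _ _) (lerD (lexx _) (h2 M w NM2 ws)).
  exact: le_trans (nm_dist_le' _ _) (lerD (lexx _) (h1 M w NM1 ws)).
pose P : {poly C} := \poly_(i < M) H i.
have PE w : P.[w] = psum H w M by rewrite /P horner_poly.
have P0 : P != 0.
  by apply/eqP => e; have [_] := GH' 0 (eq_ind_r (fun x => x <= s) (ltW s0) (nm0 R));
    rewrite -PE e horner0 nm0 ltxx.
have [rs Prs] := closed_field_poly_normal P.
have lc0 : lead_coef P != 0 by rewrite lead_coef_eq0.
have rsout : all (fun r => s < nm r) rs.
  apply/allP => r rin; rewrite ltNge; apply/negP => /GH' [_].
  by rewrite -PE Prs hornerZ horner_prod (big_rem r) //= hornerXsubC subrr mul0r mulr0 nm0 ltxx.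
have [c gc hc] := div_roots s0 rsout (geo_trunc (fun n => (lead_coef P)^-1 * G n) M (ltW s0)).
have hPc w : nm w < s -> psum H w M * ev c w = psum G w M.
  move=> ws; rewrite -PE Prs hornerZ horner_prod -mulrA.
  under eq_bigr do rewrite hornerXsubC.
  by rewrite hc // ev_trunc psumZ mulrA divff // mul1r.
(* As series, [c] times the truncated [H] is the truncated [G]; below index [M] neither truncation
   is visible. *)
have cvE n : (n < M)%N -> cauchy_prod H c n = G n.
  move=> nM; rewrite -(conv_cauchy c H nM).
  have -> : G n = trunc G M n by rewrite /trunc nM.
  apply: (@ev_inj _ _ _ s2 s); rewrite ?s20 //.
  - exact: geo_conv (ltW s0) gc.
  - exact: geo_trunc (ltW s0).
  - by move=> w ws; have ws' : nm w < s by [rewrite ws]; rewrite (ev_conv _ _ ws') // ev_trunc hPc.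
have cw n : (n < M)%N -> c n = om n.
  by apply: (cauchy_prod_inj H0) => m mM; rewrite cvE // GH.
have -> : \sum_(n < N) (nm (conv om q D n) * s2 ^+ n) ^+ 2
        = \sum_(n < N) (nm (conv c q D n) * s2 ^+ n) ^+ 2.
  apply: eq_bigr => n _; congr ((nm _ * _) ^+ 2); apply: eq_conv => m mn.
  by rewrite cw // (leq_ltn_trans mn) // (ltn_trans (ltn_ord n)) // /M; clear; lia.
apply: (@contr_conv_le _ c q D N s2 s k); rewrite ?s20 ?(le_trans (ltW s2s)) //.
  by rewrite ltW // (lt_trans ltr01).
move=> w ws; have ws' : nm w < s by rewrite ws.
have [h3 h4] := GH' w (ltW ws').
by rewrite -(ler_pM2l h4) -nmM hPc // [leRHS]mulrC.
Qed.

(** A substitute for the mean value property: Parseval domination by the constant series 1, read at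
    its first coefficient. *)
Lemma coef0_le c (s t E : R) : 0 <= s < t -> geo t c -> 0 <= E ->
  (forall w, nm w = s -> nm (ev c w) <= E) -> nm (c 0%N) <= E.
Proof.
move=> st gc E0 cE; have /andP[s0 st'] := st.
have g1 : geo t (trunc (fun=> 1) 1) by apply: geo_trunc; rewrite (le_trans s0 (ltW st')).
have h : forall N, \sum_(n < N) (nm (trunc (fun=> 1 : C) 1 n) * s ^+ n) ^+ 2 <= 1.
  case=> [|N]; first by rewrite big_ord0.
  rewrite big_ord_recl big1 ?addr0 => [|i _]; last by rewrite /trunc /= nm0 mul0r expr0n.
  by rewrite /trunc /= nm1 mul1r expr1n.
have := parseval_dom st gc g1 E0 _ h 1%N; rewrite big_ord1 mulr1 mulr1.
have dm w : nm w = s -> nm (ev c w) <= E * nm (ev (trunc (fun=> 1) 1) w).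
  by move=> ws; rewrite ev_trunc /psum big_ord1 expr0 mulr1 nm1 mulr1 cE.
by move=> /(_ dm); rewrite ler_pXn2r ?nnegrE ?nm_ge0.
Qed.

Lemma ev0 c (t : R) : 0 < t -> geo t c -> ev c 0 = c 0%N.
Proof.
move=> t0 gc; have := ev_cto (_ : nm 0 < t) gc; rewrite nm0 => /(_ t0) h.
apply: (cto_unique h) => eps /ltW e0; exists 1%N => -[//|N] _.
rewrite /psum big_ord_recl expr0 mulr1 big1 ?addr0 ?subrr ?nm0 // => i _.
by rewrite /= /bump /= add1n expr0n mulr0.
Qed.

(* Zeros of [H] are removed one at a time by multiplying with the factor
   [(r - z^* w / r) / (w - z)], of modulus 1 on the circle [|w| = r]; each step
   multiplies [|H(0)|] by at least [r / s], while [|H(0)| <= E] throughout. *)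
Lemma dominated_quotient (s r t E : R) : 0 < s < r -> r < t -> t <= 1 -> 0 <= E ->
  forall j G H om, geo t G -> geo t H ->
  (forall w, nm w < t -> nm (ev G w) <= nm (ev H w)) ->
  (forall w, nm w = r -> nm (ev H w) <= E) -> H 0%N != 0 ->
  E < nm (H 0%N) * (r / s) ^+ j ->
  G =1 cauchy_prod H om -> semicontr s om.
Proof.
move=> /andP[s0 sr] rt t1 E0; have r0 := lt_trans s0 sr; have t0 := lt_trans r0 rt.
have st := lt_trans sr rt.
elim=> [|j IH] G H om gG gH dom HE H0 Ej GH.
  (* With no division left, [Ej] says that the value at 0 exceeds the maximum on the circle, which
     is absurd. *)
  have := @coef0_le H r t E _ gH E0 HE; rewrite (ltW r0) rt => /(_ isT).
  by move: Ej; rewrite expr0 mulr1 => /lt_le_trans h /h; rewrite ltxx.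
have [[z zs Hz]|nz] := pselect (exists2 z, nm z <= s & ev H z = 0); last first.
  have nz' w : nm w <= s -> ev H w != 0.
    by move=> ws; apply/eqP => e; apply: nz; exists w.
  have st0 : 0 < s < t by rewrite s0.
  have [d d0 Hd] := ev_min st0 gH nz'.
  by apply: (@zero_free_quotient G H om s t d); rewrite ?s0 // (le_trans _ t1) // ltW.
have zt := le_lt_trans zs st.
have Gz : ev G z = 0.
  by apply/eqP; rewrite -nm_eq0 eq_le nm_ge0 andbT (le_trans (dom _ zt)) // Hz nm0.
have z0 : z != 0.
  by apply/eqP => e; move: Hz; rewrite e (ev0 t0 gH) => /eqP; rewrite (negbTE H0).
pose G2 := divlin z G; pose H2 := divlin z H.
have gG2 : geo t G2 by exact: geo_divlin_zero.
have gH2 : geo t H2 by exact: geo_divlin_zero.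
have evG w : nm w < t -> ev G w = (w - z) * ev G2 w.
  move=> wt; rewrite -(ev_ext _ (divlinK G z0)) (ev_lin _ _ wt gG2).
  by rewrite mul1r addrC.
have evH w : nm w < t -> ev H w = (w - z) * ev H2 w.
  move=> wt; rewrite -(ev_ext _ (divlinK H z0)) (ev_lin _ _ wt gH2).
  by rewrite mul1r addrC.
have dom2 : forall w, nm w < t -> nm (ev G2 w) <= nm (ev H2 w).
  apply: (@dom_fill _ _ _ z t) => // w wz wt.
  have w0 : 0 < nm (w - z) by rewrite nm_gt0 subr_eq0.
  by rewrite -(ler_pM2l w0) -!nmM -evG // -evH // dom.
have rC : r%:C != 0 :> C by rewrite -nm_gt0 nm_real gtr0_norm.
pose b : C := - z^* / r%:C.
apply: (IH (lin r%:C b G2) (lin r%:C b H2)).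
- exact: geo_lin (ltW t0) gG2.
- exact: geo_lin (ltW t0) gH2.
- by move=> w wt; rewrite !(ev_lin _ _ wt) // !nmM ler_wpM2l ?nm_ge0 ?dom2.
- move=> w wr; have wt : nm w < t by rewrite wr.
  apply: le_trans (HE _ wr); rewrite (ev_lin _ _ wt) // evH // !nmM.
  rewrite ler_wpM2r ?nm_ge0 //.
  (* On the circle [r^2] is [w] times its conjugate, so [r + b w] is [w / r] times the conjugate of
     [w - z], of modulus [|w - z|]. *)
  have ww : r%:C * r%:C = w * w^* by rewrite mul_conj wr -rmorphM.
  have -> : r%:C + b * w = w / r%:C * (w - z)^*.
    by apply: (mulIf rC); rewrite mulrDl ww /b rmorphB; field.
  by rewrite !nmM nm_conj nmV nm_real wr gtr0_norm // divff ?mul1r // gt_eqF.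
- rewrite /lin mulr0 addr0 mulf_neq0 // /H2 /divlin /psum big_ord1 expr0 mulr1.
  by rewrite mulf_neq0 ?oppr_eq0 ?invr_eq0 ?expf_neq0.
- apply: (lt_le_trans Ej); rewrite /lin mulr0 addr0 /H2 /divlin /psum big_ord1.
  rewrite expr0 expr1 mulr1 !nmM nmN nmV nm_real gtr0_norm // exprS [leLHS]mulrA.
  rewrite ler_wpM2r ?exprn_ge0 ?divr_ge0 ?(ltW r0) ?(ltW s0) //.
  rewrite [leRHS]mulrCA ler_wpM2l ?nm_ge0 // ler_wpM2l ?(ltW r0) //.
  by rewrite lef_pV2 ?posrE // nm_gt0.
(* [G] and [H] undergo the same division and the same multiplication, so [om] stays their formal
   quotient; the factor [w - z] is cancelled by [lin_inj]. *)
- move=> n; rewrite cauchy_prod_lin; congr (lin _ _ _ n); apply/funext.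
  apply: (@lin_inj _ (- z) 1); first by rewrite oppr_eq0.
  move=> i; rewrite divlinK // GH -cauchy_prod_lin.
  by apply: eq_bigr => l _; rewrite divlinK.
Qed.

Lemma contr_quotient_nz G H : (forall t, 0 < t < 1 -> geo t G) ->
  (forall t, 0 < t < 1 -> geo t H) ->
  (forall w, nm w < 1 -> nm (ev G w) <= nm (ev H w)) -> H 0%N != 0 ->
  exists2 om, contr om & G =1 cauchy_prod H om.
Proof.
move=> gG gH dom Hv.
have [om GH] := ex_cauchy_quotient G Hv; exists om => //.
(* The loss allowed in [semicontr] will be [k = s^-1]; its square accounts for the exponent 2. *)
apply: (@contr_lim _ _ 2) => q D N s /andP[s0 s1].
pose s' := (1 + s) / 2; pose r := (1 + s') / 2; pose t := (1 + r) / 2.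
have ss' : s < s' by rewrite /s'; lra.
have s'1 : s' < 1 by rewrite /s'; lra.
have s'r : s' < r by rewrite /r; lra.
have r1 : r < 1 by rewrite /r; lra.
have rt : r < t by rewrite /t; lra.
have t1 : t < 1 by rewrite /t; lra.
have s'0 := lt_trans s0 ss'; have r0 := lt_trans s'0 s'r; have t0 := lt_trans r0 rt.
have t01 : 0 < t < 1 by rewrite t0.
have [|E E0 HE] := @ev_bounded R H r t _ (gH _ t01); first by rewrite ltW.
have x01 : 0 <= s' / r < 1.
  by rewrite divr_ge0 ?(ltW r0) ?(ltW s'0) //= ltr_pdivrMr // mul1r.
have n0 : 0 < nm (H 0%N) by rewrite nm_gt0.
have E1 : 0 < E + 1 by lra.
(* A budget of divisions: multiplied by [(r / s') ^+ j], the modulus of [H 0] is at least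
   [E + 1]. *)
have [j hj] := expr_small x01 (divr_gt0 n0 E1).
have sc : semicontr s' om.
  apply: (@dominated_quotient s' r t E _ rt (ltW t1) E0 j G H om) => //.
  - by rewrite s'0.
  - exact: gG.
  - exact: gH.
  - by move=> w wt; apply: dom; exact: lt_trans t1.
  - by move=> w wr; apply: HE; rewrite wr.
  - have := hj j (leqnn j); rewrite ler_pdivlMr // => h.
    have xj : 0 < (r / s') ^+ j by rewrite exprn_gt0 // divr_gt0.
    apply: (@lt_le_trans _ _ (E + 1)); first by rewrite ltrDl.
    rewrite -(ler_pM2l (exprn_gt0 j (divr_gt0 s'0 r0))) mulrCA -exprMn.
    by rewrite mulrA divfK ?gt_eqF // divff ?gt_eqF // expr1n mulr1.
have sV : 1 < s^-1 by rewrite invf_gt1.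
have := sc s s^-1 q D N _ sV; rewrite s0 ss' => /(_ isT).
by rewrite exprVn -ler_pdivrMl ?invr_gt0 ?exprn_gt0 // invrK.
Qed.

(** A zero of [H] at the origin is out of reach of the Blaschke step, which divides by [z].
    Domination makes [G] vanish there too, so both sequences are shifted until [H 0] is nonzero. *)
Lemma contr_quotient G H : (forall t, 0 < t < 1 -> geo t G) ->
  (forall t, 0 < t < 1 -> geo t H) ->
  (forall w, nm w < 1 -> nm (ev G w) <= nm (ev H w)) ->
  exists2 om, contr om & G =1 cauchy_prod H om.
Proof.
move=> gG gH dom.
have [[N HN]|Hz] := pselect (exists N, H N != 0); last first.
  have H0 : H =1 fun=> 0.
    by move=> n; apply/eqP; apply: contra_notT Hz => h; exists n.
  exists (fun=> 0).
    move=> q D N; rewrite big1 => [|n _]; first by apply: sumr_ge0 => i _; exact: sqr_ge0.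
    by rewrite /conv big1 ?nm0 ?expr0n // => i _; rewrite /smul mulr0 if_same.
  move=> n; rewrite /cauchy_prod big1 => [|i _]; last by rewrite mulr0.
  have h2 : 0 < (2^-1 : R) < 1 by apply/andP; split; lra.
  have h4 : 0 < (4^-1 : R) < 2^-1 by apply/andP; split; lra.
  have g0 : geo (2^-1) (fun=> 0 : C) by exists 0 => m; rewrite nm0 mul0r.
  apply: (ev_inj h4 (gG _ h2) g0) => w ws.
  apply/eqP; rewrite ev_zero -nm_eq0 eq_le nm_ge0 andbT.
  apply: le_trans (dom w _) _; first by rewrite ws; lra.
  by rewrite (ev_ext _ H0) ev_zero nm0.
elim: N => [|N IH] in G H gG gH dom HN *; first exact: contr_quotient_nz.
have [H0|H0] := eqVneq (H 0%N) 0; last exact: contr_quotient_nz.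
have G0 : G 0%N = 0.
  have h2 : 0 < (2^-1 : R) < 1 by apply/andP; split; lra.
  have /andP[p0 _] := h2.
  apply/eqP; rewrite -nm_eq0 eq_le nm_ge0 andbT -(ev0 p0 (gG _ h2)).
  apply: le_trans (dom 0 _) _; first by rewrite nm0.
  by rewrite (ev0 p0 (gH _ h2)) H0 nm0.
have gS c t : 0 < t < 1 -> geo t c -> geo t (fun n => c n.+1).
  move=> /andP[t0 _] [B cB]; exists (B / t) => n.
  by rewrite ler_pdivlMr // -mulrA -exprSr.
have evS c t w : 0 < t < 1 -> nm w < t -> geo t c -> c 0%N = 0 ->
    ev c w = w * ev (fun n => c n.+1) w.
  move=> t01 wt gc c0; have := ev_smul 1 1 wt (gS _ _ t01 gc).
  rewrite expr1 mul1r => <-; apply: ev_ext => -[|n]; first by rewrite /smul.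
  by rewrite /smul /= subn1 mul1r.
have [||w|om hom GH] := IH (fun n => G n.+1) (fun n => H n.+1) _ _ _ HN.
- by move=> t t01; exact: gS (gG _ t01).
- by move=> t t01; exact: gS (gH _ t01).
- have gS' c : (forall t, 0 < t < 1 -> geo t c) ->
      (forall t, 0 < t < 1 -> geo t (fun n => c n.+1)).
    by move=> gc t t01; exact: gS (gc _ t01).
  have lt_avg x : nm x < 1 -> 0 < (1 + nm x) / 2 < 1 /\ nm x < (1 + nm x) / 2.
    have n0 := nm_ge0 x; move: (nm x) n0 => a a0 a1; split; last by lra.
    by apply/andP; split; lra.
  move=> w1; pose t := (1 + nm w) / 2.
  have /andP[t0 t1] : 0 < t < 1 by case: (lt_avg _ w1).
  have wt : nm w < t by case: (lt_avg _ w1).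
  have t01 : 0 < t < 1 by rewrite t0.
  apply: (@dom_fill _ _ _ 0 t t0 (gS' _ gG _ t01) (gS' _ gH _ t01)) wt => x x0 xt.
  have nx : 0 < nm x by rewrite nm_gt0.
  have := dom x (lt_trans xt t1).
  rewrite (evS G t x t01 xt (gG _ t01) G0) (evS H t x t01 xt (gH _ t01) H0).
  by rewrite !nmM ler_pM2l.
exists om => // -[|n]; first by rewrite G0 /cauchy_prod big_ord1 H0 mul0r.
rewrite GH /cauchy_prod [RHS]big_ord_recl H0 mul0r add0r.
by apply: eq_bigr => i _; rewrite /= /bump /= add1n subSS.
Qed.

End Quotient.

(** * Coefficients of dominated power series *)

Section Causal.
Variable R : realType.
Local Notation C := R[i].
Local Notation nm := (@Normc.normc R).
Implicit Types (c e q G H om : nat -> C) (w v : C).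

Lemma abel_le (x y u : nat -> R) N :
  (forall M, \sum_(n < M) x n <= \sum_(n < M) y n) ->
  (forall n, 0 <= u n.+1 <= u n) -> (0 <= u 0%N) ->
  \sum_(n < N) u n * x n <= \sum_(n < N) u n * y n.
Proof.
move=> xy ud u0; pose D M := \sum_(n < M) (y n - x n).
have D0 M : 0 <= D M by rewrite /D sumrB subr_ge0.
(* Nonnegativity alone does not carry through the induction; the boundary term of the summation by
   parts has to be kept. *)
suff key M : u M * D M.+1 <= \sum_(n < M.+1) u n * (y n - x n).
  have uN n : 0 <= u n by case: n => // n; case/andP: (ud n).
  rewrite -subr_ge0 -sumrB; under eq_bigr do rewrite -mulrBr.
  by case: N => [|N]; rewrite ?big_ord0 // (le_trans _ (key N)) // mulr_ge0.
elim: M => [|M IH]; first by rewrite /D !big_ord1.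
rewrite [leRHS]big_ord_recr /= /D big_ord_recr /= -/(D M.+1) mulrDr lerD2r.
apply: le_trans IH; rewrite ler_wpM2r //; by case/andP: (ud M).
Qed.

Lemma cauchy_prod_sqr_le G H om N : contr om -> G =1 cauchy_prod H om ->
  \sum_(n < N) nm (G n) ^+ 2 <= \sum_(n < N) nm (H n) ^+ 2.
Proof.
move=> hom GH; apply: le_trans (hom H N N); apply: ler_sum => n _.
by rewrite GH conv_cauchy.
Qed.

(** Grouped by the index [i] of [H], the bound is [nm (H i) * s ^+ i] times a Bohr sum of [om],
    which is at most 1. *)
Lemma cauchy_prod_bohr G H om (s : R) N : contr om -> G =1 cauchy_prod H om ->
  0 <= s <= 3^-1 ->
  \sum_(n < N) nm (G n) * s ^+ n <= \sum_(n < N) nm (H n) * s ^+ n.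
Proof.
move=> hom GH s03; have /andP[s0 _] := s03.
apply: (@le_trans _ _ (\sum_(n < N) \sum_(i < N) nm (smul (H i) i om n) * s ^+ n)).
  apply: ler_sum => n _; rewrite -mulr_suml ler_wpM2r ?exprn_ge0 //.
  by rewrite GH -(conv_cauchy om H (ltn_ord n)); exact: nm_sum.
rewrite exchange_big; apply: ler_sum => i _ /=.
have iN := ltnW (ltn_ord i); move: (nat_of_ord i) iN => {}i iN.
rewrite -(subnKC iN) big_split_ord /= big1 => [|n _]; last first.
  by rewrite /smul leqNgt ltn_ord nm0 mul0r.
rewrite add0r; move: (N - i)%N => M.
rewrite -[leRHS]mulr1; apply: le_trans (ler_wpM2l _ (bohr_contr M hom s03)); last first.
  by rewrite mulr_ge0 ?nm_ge0 ?exprn_ge0.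
rewrite mulr_sumr; apply: ler_sum => n _.
rewrite /smul leq_addr addKn nmM exprD le_eqVlt; apply/orP; left; apply/eqP; ring.
Qed.

(* [e n] is the exponent of the n-th term before differentiation. *)
Lemma dominated_coefs (al be : nat -> C) (e : nat -> nat) (d s : R) N :
  0 <= d -> 0 <= s <= 3^-1 -> (0 < e 0%N)%N -> (forall n, (e n <= e n.+1)%N) ->
  (exists2 om, contr om & (fun n => (e n)%:R * be n)
      =1 cauchy_prod (fun n => d%:C * ((e n)%:R * al n)) om) ->
  \sum_(n < N) nm (be n) * s ^+ n <= d * \sum_(n < N) nm (al n) * s ^+ n /\
  \sum_(n < N) (nm (be n) * s ^+ n) ^+ 2
     <= d ^+ 2 * \sum_(n < N) (nm (al n) * s ^+ n) ^+ 2.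
Proof.
move=> d0 s03 e0 eS [om hom GH]; have /andP[s0 s3] := s03.
have ep n : (0 < e n)%N by elim: n => // n IH; exact: leq_trans (eS n).
have er n : 0 < (e n)%:R :> R by rewrite ltr0n.
have en n : (e n)%:R != 0 :> R by rewrite gt_eqF.
have iS n : 0 <= ((e n.+1)%:R^-1 : R) <= (e n)%:R^-1.
  by rewrite invr_ge0 ler0n lef_pV2 ?posrE // ler_nat eS.
have i0 n : 0 <= (e n)%:R^-1 :> R by rewrite invr_ge0.
have s1 : s <= 1 by lra.
split.
- have := @abel_le (fun n => nm ((e n)%:R * be n) * s ^+ n)
    (fun n => nm (d%:C * ((e n)%:R * al n)) * s ^+ n) (fun n => (e n)%:R^-1) N
    (fun M => cauchy_prod_bohr M hom GH s03) iS (i0 0%N).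
  rewrite mulr_sumr; congr (_ <= _); apply: eq_bigr => n _.
    by rewrite nmM nm_nat !mulrA mulVf // mul1r.
  by rewrite !nmM nm_nat nm_real ger0_norm //; field.
- pose u n := (s ^+ n / (e n)%:R) ^+ 2.
  have u0 n : 0 <= u n by exact: sqr_ge0.
  have uS n : 0 <= u n.+1 <= u n.
    rewrite u0 /= /u lerXn2r ?nnegrE ?mulr_ge0 ?exprn_ge0 ?i0 //.
    case/andP: (iS n) => _ h; rewrite ler_pM ?exprn_ge0 ?i0 //.
    by rewrite ler_wiXn2l.
  (* The l^2 comparison carries no power of [s], so the decreasing weight [u] supplies both [s^(2n)]
     and the inverse square of [e n]. *)
  have := @abel_le (fun n => nm ((e n)%:R * be n) ^+ 2)
    (fun n => nm (d%:C * ((e n)%:R * al n)) ^+ 2) u N (fun M => cauchy_prod_sqr_le M hom GH) uS (u0 0%N).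
  rewrite mulr_sumr; congr (_ <= _); apply: eq_bigr => n _; rewrite /u.
    by rewrite nmM nm_nat; field.
  by rewrite !nmM nm_nat nm_real ger0_norm //; field.
Qed.

(** The factor [s ^+ 2] avoids the exponent [n - 2], and [n^2] is a convenient majorant of
    [n (n - 1) / 2]. At [n = 0] the truncated [n.-1] is multiplied by 0. *)
Lemma taylor_expr w v (s : R) n : nm w <= s -> nm v <= s ->
  nm (w ^+ n - v ^+ n - (w - v) * (n%:R * v ^+ n.-1)) * s ^+ 2
  <= (n%:R * n%:R) * s ^+ n * nm (w - v) ^+ 2.
Proof.
move=> ws vs; have s0 := le_trans (nm_ge0 w) ws.
elim: n => [|n IH]; first by rewrite subrr !mul0r mulr0 subrr nm0 mul0r.
have -> : w ^+ n.+1 - v ^+ n.+1 - (w - v) * (n.+1%:R * v ^+ n.+1.-1)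
  = w * (w ^+ n - v ^+ n - (w - v) * (n%:R * v ^+ n.-1))
    + (w - v) ^+ 2 * (n%:R * v ^+ n.-1).
  case: n {IH} => [|n]; rewrite ?expr1 ?expr0 /=; first by ring.
  rewrite -[n.+2%:R]natr1 !exprS; ring.
have vn : nm (n%:R * v ^+ n.-1) * s ^+ 2 <= n%:R * (s ^+ n.+1).
  rewrite nmM nm_nat -mulrA; case: n {IH} => [|n] /=; first by rewrite !mul0r.
  rewrite ler_wpM2l // nmX -[s ^+ n.+2]/(s ^+ (2 + n)) addnC exprD.
  by rewrite ler_wpM2r ?sqr_ge0 // lerXn2r ?nnegrE ?nm_ge0.
apply: (@le_trans _ _ (s * (n%:R * n%:R * s ^+ n * nm (w - v) ^+ 2)
    + nm (w - v) ^+ 2 * (n%:R * s ^+ n.+1))).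
  apply: le_trans (ler_wpM2r (sqr_ge0 s) (nmD _ _)) _.
  rewrite mulrDl; apply: lerD.
    rewrite nmM -[leLHS]mulrA; apply: ler_pM => //; rewrite ?nm_ge0 // mulr_ge0 ?nm_ge0 //.
    exact: sqr_ge0.
  by rewrite nmM nmX -[leLHS]mulrA ler_wpM2l ?sqr_ge0.
rewrite -[n.+1%:R]natr1 !exprS.
have n0 : 0 <= n%:R :> R by exact: ler0n.
have Y0 : 0 <= nm (w - v) ^+ 2 by exact: sqr_ge0.
have Q0 : 0 <= s * s ^+ n by rewrite mulr_ge0 ?exprn_ge0.
rewrite -!exprS; move: (nm (w - v) ^+ 2) Y0 => Y Y0.
rewrite exprS; move: Q0; move: (s ^+ n) => S Q0; move: (n%:R : R) n0 => a a0.
have : 0 <= (a + 1) * (s * S) * Y by apply: mulr_ge0 => //; apply: mulr_ge0 => //; lra.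
lra.
Qed.

End Causal.

(** * Lacunary expansions *)

Section Lacunary.
Variable R : realType.
Local Notation C := R[i].
Local Notation nm := (@Normc.normc R).
Variables (k m p : nat).
Hypotheses (m0 : (0 < m)%N) (p0 : (0 < p)%N).
Implicit Types (c e q G H om : nat -> C) (w v z : C) (phi : Cplx R -> Cplx R).

Definition lac_exp j := (p * (k + j) + m)%N.
Definition lac c j := c (lac_exp j).
Local Notation K := (lac_exp 0).

Lemma lac_expE j : lac_exp j = (K + p * j)%N.
Proof. by rewrite /lac_exp addn0 mulnDr addnAC. Qed.

Lemma lac_exp_gt0 j : (0 < lac_exp j)%N.
Proof. by rewrite /lac_exp addn_gt0 m0 orbT. Qed.

Lemma ex_root w : exists z, z ^+ p = w.
Proof. by exists (p.-root w)%C; rewrite rootCK. Qed.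

Lemma expr_lt1_nm z : (nm (z ^+ p) < 1) = (nm z < 1).
Proof. by rewrite nmX expr_lt1 // nm_ge0. Qed.

Lemma expansion_cto phi c z : has_expansion k m p phi c -> nm z < 1 ->
  cto (fun N => z ^+ K * psum (lac c) (z ^+ p) N) (phi z).
Proof.
move=> hphi z1 eps e0; have [N0 h] := cto_cvg (hphi z z1) e0.
exists N0 => N NN; have := h (N + k)%N (leq_trans NN (leq_addr _ _)).
rewrite -{1}[k]add0n big_addn addnK big_mkord.
rewrite /psum mulr_sumr; congr (nm (_ - _) <= _); apply: eq_bigr => n _.
rewrite mulrCA -exprM -exprD; congr (_ * _).
  by rewrite /lac /lac_exp [(k + _)%N]addnC.
by rewrite -lac_expE /lac_exp [(k + _)%N]addnC.
Qed.

Lemma cto_bounded u v : cto u v -> exists B : R, forall N, nm (u N) <= B.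
Proof.
move=> /(_ _ (ltr01 : 0 < (1 : R))) [N0 h].
exists (nm v + 1 + \sum_(i < N0) nm (u i)) => N.
have S0 : 0 <= \sum_(i < N0) nm (u i) by apply: sumr_ge0 => i _; exact: nm_ge0.
case: (leqP N0 N) => [NN|NN].
  apply: le_trans (nm_dist_le' _ v) _; have := h _ NN.
  by move: (nm v) (nm (v - u N)) => a b; lra.
rewrite (bigD1 (Ordinal NN)) //= addrCA lerDl addr_ge0 ?addr_ge0 ?nm_ge0 //.
by apply: sumr_ge0 => i _; exact: nm_ge0.
Qed.

(** At [z] with [z ^+ p = t] the partial sums converge, hence are bounded, and each term is the
    difference of two consecutive ones. *)
Lemma geo_lac phi c t : has_expansion k m p phi c -> 0 < t < 1 -> geo t (lac c).
Proof.
move=> hphi /andP[t0 t1]; have [z zt] := ex_root t%:C.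
have nz : nm z ^+ p = t by rewrite -nmX zt nm_real gtr0_norm.
have z1 : nm z < 1 by rewrite -expr_lt1_nm nmX nz.
have [B hB] := cto_bounded (expansion_cto hphi z1).
have zK : 0 < nm z ^+ K.
  rewrite exprn_gt0 // lt_neqAle nm_ge0 andbT eq_sym; apply/eqP => e.
  by move: t0; rewrite -nz e expr0n (gtn_eqF p0) ltxx.
exists ((B + B) / nm z ^+ K) => n; rewrite ler_pdivlMr //.
apply: le_trans (lerD (hB n.+1) (hB n)); rewrite -nz -!nmX -!nmM.
apply: le_trans (nmB _ _); rewrite -mulrBr.
have -> : psum (lac c) (z ^+ p) n.+1 - psum (lac c) (z ^+ p) n = lac c n * (z ^+ p) ^+ n.
  by rewrite /psum big_ord_recr /= addrAC subrr add0r.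
by rewrite mulrC.
Qed.

Lemma expansion_ev phi c z : has_expansion k m p phi c -> nm z < 1 ->
  phi z = z ^+ K * ev (lac c) (z ^+ p).
Proof.
move=> hphi z1; apply: (cto_unique (expansion_cto hphi z1)).
have w1 : nm (z ^+ p) < 1 by rewrite expr_lt1_nm.
have n0 := nm_ge0 (z ^+ p); pose t := (1 + nm (z ^+ p)) / 2.
have [t01 wt] : 0 < t < 1 /\ nm (z ^+ p) < t.
  by rewrite /t; move: (nm _) n0 w1 => a a0 a1; split; [apply/andP; split|]; lra.
exact: ctoZ (ev_cto wt (geo_lac hphi t01)).
Qed.

(** For [w = z^p] the bound on [phi] gives [|z|^-K] for the series at [w], hence [|w|^-K] because
    [|w| <= |z|]. *)
Lemma lac_contr phi c : has_expansion k m p phi c ->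
  (forall z, nm z < 1 -> nm (phi z) <= 1) -> contr (lac c).
Proof.
move=> hphi phi1; apply: (@contr_of_bound _ _ K).
  by move=> t; exact: geo_lac hphi.
move=> s w /andP[s0 s1] ws; have [z zw] := ex_root w.
have z1 : nm z < 1 by rewrite -expr_lt1_nm zw ws.
have := phi1 z z1; rewrite (expansion_ev hphi z1) zw nmM nmX mulrC.
apply: le_trans; rewrite ler_wpM2l ?nm_ge0 // -ws -zw nmX -exprM.
by rewrite ler_wiXn2l ?nm_ge0 ?(ltW z1) // leq_pmull.
Qed.

Definition lac_deriv c j : C := (lac_exp j)%:R * lac c j.

Lemma geo_lac_exp e (s t : R) : 0 <= s < t -> geo t e ->
  geo s (fun j => (lac_exp j)%:R * e j).
Proof.
move=> st ge; have /andP[s0 st'] := st.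
apply: (@geo_ext _ _ (fun j => K%:R * e j + p%:R * (j%:R * e j))).
  by move=> j; rewrite [in RHS]lac_expE natrD natrM; ring.
apply: geoD => //; apply: geoZ; last exact: geo_deriv ge.
by apply: geo_le ge; rewrite s0 ltW.
Qed.

Lemma geo_lac_deriv phi c t : has_expansion k m p phi c -> 0 < t < 1 ->
  geo t (lac_deriv c).
Proof.
move=> hphi /andP[t0 t1]; pose t' := (1 + t) / 2.
have t'1 : 0 < t' < 1 by rewrite /t'; apply/andP; split; lra.
have tt' : 0 <= t < t' by rewrite /t'; apply/andP; split; lra.
exact: geo_lac_exp tt' (geo_lac hphi t'1).
Qed.

Lemma expansion_taylor phi c (s : R) : has_expansion k m p phi c -> 0 < s < 1 ->
  exists2 A, 0 <= A & forall w v, nm w <= s -> nm v <= s ->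
    nm (phi w - phi v - (w - v) * (v ^+ K.-1 * ev (lac_deriv c) (v ^+ p)))
    <= A * nm (w - v) ^+ 2.
Proof.
move=> hphi /andP[s0 s1]; have sp1 : s ^+ p < 1 by rewrite expr_lt1 // ltW.
have sp0 : 0 < s ^+ p by rewrite exprn_gt0.
pose t := (1 + s ^+ p) / 2.
have t01 : 0 < t < 1 by rewrite /t; apply/andP; split; lra.
pose r := (t + s ^+ p) / 2.
have rt : 0 <= r < t by rewrite /r /t; apply/andP; split; lra.
have sr : 0 <= s ^+ p < r by rewrite /r /t; apply/andP; split; lra.
have [A A0 hA] := geo_sum sr (geo_lac_exp rt (geo_lac_deriv hphi t01)).
exists (s ^+ K * A / s ^+ 2); first by rewrite !mulr_ge0 ?invr_ge0 ?exprn_ge0 ?(ltW s0).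
move=> w v ws vs; have w1 := le_lt_trans ws s1; have v1 := le_lt_trans vs s1.
have vpt : nm (v ^+ p) < t.
  rewrite nmX; apply: (@le_lt_trans _ _ (s ^+ p)); last by rewrite /t; lra.
  by rewrite lerXn2r ?nnegrE ?nm_ge0 ?(ltW s0).
have hD := ctoZ (w - v) (ctoZ (v ^+ K.-1) (ev_cto vpt (geo_lac_deriv hphi t01))).
have hC := ctoB (ctoB (expansion_cto hphi w1) (expansion_cto hphi v1)) hD.
apply: (cto_le (N1 := 0) hC) => N _ {hC hD}.
rewrite mulrAC ler_pdivlMr ?exprn_gt0 //.
have -> : w ^+ K * psum (lac c) (w ^+ p) N - v ^+ K * psum (lac c) (v ^+ p) N
    - (w - v) * (v ^+ K.-1 * psum (lac_deriv c) (v ^+ p) N)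
  = \sum_(j < N) lac c j * (w ^+ lac_exp j - v ^+ lac_exp j
      - (w - v) * ((lac_exp j)%:R * v ^+ (lac_exp j).-1)).
  rewrite /psum !mulr_sumr -!sumrB; apply: eq_bigr => j _.
  have -> : (lac_exp j).-1 = (K.-1 + p * j)%N.
    by rewrite lac_expE; have := lac_exp_gt0 0; case: (lac_exp 0).
  rewrite /lac_deriv; move: (lac c j) => x; rewrite !(lac_expE j) !exprD !exprM; ring.
apply: le_trans (ler_wpM2r (sqr_ge0 s) (nm_sum _ _ _)) _; rewrite mulr_suml.
apply: (@le_trans _ _ (\sum_(j < N) s ^+ K * nm (w - v) ^+ 2 *
    (nm ((lac_exp j)%:R * lac_deriv c j) * (s ^+ p) ^+ j))).
  apply: ler_sum => j _; rewrite nmM -[leLHS]mulrA.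
  apply: le_trans (ler_wpM2l (nm_ge0 _) (taylor_expr _ ws vs)) _.
  rewrite /lac_deriv !nmM !nm_nat -exprM [in s ^+ _](lac_expE j) exprD.
  by rewrite le_eqVlt; apply/orP; left; apply/eqP; ring.
rewrite -mulr_sumr [leRHS]mulrAC ler_wpM2l //.
by rewrite mulr_ge0 ?exprn_ge0 ?nm_ge0 ?(ltW s0).
Qed.

Lemma expansion_derive1 phi c v : has_expansion k m p phi c -> nm v < 1 ->
  phi^`() v = v ^+ K.-1 * ev (lac_deriv c) (v ^+ p).
Proof.
move=> hphi v1; set D := _ * _; pose s := (1 + nm v) / 2.
have n0 := nm_ge0 v.
have [s01 vs] : 0 < s < 1 /\ nm v < s.
  by rewrite /s; move: (nm v) n0 v1 => a a0 a1; split; [apply/andP; split|]; lra.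
have [A A0 hA] := expansion_taylor hphi s01.
rewrite derive1E; apply: cvg_lim => //.
apply/cvgrPdist_le => /= eps; case: eps => e i.
(* A positive element of [R[i]] has zero imaginary part, so the tolerance is a real number [e]. *)
rewrite ltcE /= => /andP[/eqP -> e0].
pose dl := Num.min (s - nm v) (e / (A + 1)).
have A1 : 0 < A + 1 by rewrite ltr_wpDl.
have d0 : 0 < dl by rewrite lt_min subr_gt0 vs divr_gt0.
have ds : dl <= s - nm v by rewrite ge_min lexx.
have dA : dl * (A + 1) <= e by rewrite -ler_pdivlMr // ge_min lexx orbT.
rewrite near_withinE; apply/nbhs_ballP; exists dl%:C => /=; first by rewrite ltcR.
move=> t; rewrite -ball_normE /= sub0r normrN norm_nm ltcR => td t0.
rewrite norm_nm -/(real_complex R e) lecR.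
have tn : 0 < nm t by rewrite nm_gt0.
have -> : t%:A = t by rewrite /GRing.scale /= mulr1.
have wv : nm (t + v) <= s.
  apply: le_trans (nmD _ _) _; move: (nm t) (nm v) td ds => a b; lra.
have := hA (t + v) v wv (ltW vs); rewrite addrK -/D => h.
have -> : D - t^-1 *: (phi (t + v) - phi v) = - (t^-1 * (phi (t + v) - phi v - t * D)).
  by rewrite /GRing.scale /= [in RHS]mulrBr mulKf // opprB.
rewrite nmN nmM nmV -ler_pdivlMl ?invr_gt0 // invrK.
apply: le_trans h _; rewrite expr2 mulrA mulrC ler_pM2l //.
apply: le_trans dA; rewrite mulrC.
apply: ler_pM; rewrite ?nm_ge0 ?(ltW td) // lerDl //.
Qed.

End Lacunary.

(** * The radius, and the final estimate *)

Section RootOfT.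
Variables (R : realType) (k m p : nat) (d : R).
Hypotheses (hk : (1 <= k)%N) (hp : (1 <= p)%N) (hd : 0 <= d).
Implicit Types r x y : R.

Let d1 : 0 < 2 / (d + 1). Proof. by rewrite divr_gt0 // ltr_wpDl. Qed.
Let pK : (p <= p * k + m)%N. Proof. nia. Qed.

(** As [k >= 1], a factor [r^p] can be split off [r^(pk+m)]. With [X = r^p], the product [X (3 - X)]
    is nondecreasing on [0,1], and strictness comes from [1 - X]. *)
Lemma t_decreasing x y : 0 <= x < y -> y <= 1 -> t_ k m p d y < t_ k m p d x.
Proof.
move=> /andP[x0 xy] y1; have y0 := le_trans x0 (ltW xy).
rewrite /t_ -(subnKC pK) !exprD.
have X1 : x ^+ p < y ^+ p by rewrite ltrXn2r // -lt0n.
have Y1 : y ^+ p <= 1 by rewrite exprn_ile1.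
have X0 : 0 <= x ^+ p by rewrite exprn_ge0.
have A0 : 0 <= x ^+ (p * k + m - p) by rewrite exprn_ge0.
have AB : x ^+ (p * k + m - p) <= y ^+ (p * k + m - p).
  by rewrite lerXn2r ?nnegrE // ltW.
move: (x ^+ p) (y ^+ p) (x ^+ _) (y ^+ _) X1 Y1 X0 A0 AB => X Y A B X1 Y1 X0 A0 AB.
apply: ltr_leB; first by rewrite ltr_pM2l // ltrD2l ltrN2.
rewrite mulrAC [leRHS]mulrAC; apply: ler_pM => //; first by rewrite mulr_ge0 //; lra.
nra.
Qed.

Lemma t_continuous : continuous (t_ k m p d).
Proof.
move=> x; rewrite /t_; apply: cvgB; apply: cvgM.
- exact: cvg_cst.
- by apply: cvgB; [exact: cvg_cst|exact: exprn_continuous].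
- exact: exprn_continuous.
- by apply: cvgB; [exact: cvg_cst|exact: exprn_continuous].
Qed.

Lemma t_unique_root : exists! r, 0 < r < 1 /\ t_ k m p d r = 0.
Proof.
have t0 : t_ k m p d 0 = 2 / (d + 1).
  rewrite /t_ !expr0n !gtn_eqF ?(leq_trans hp pK) //=; ring.
have t1 : t_ k m p d 1 = - 2 by rewrite /t_ !expr1n; ring.
have [||r] := @IVT _ (t_ k m p d) 0 1 0 ler01.
- exact: continuous_subspaceT t_continuous.
- by rewrite t0 t1 ge_min le_max (ltW d1) oppr_le0 ler0n orbT.
rewrite in_itv /= => /andP[r0 r1] tr.
have r0' : 0 < r.
  rewrite lt_neqAle r0 andbT eq_sym; apply/eqP => e; move: tr; rewrite e t0 => e2.
  by move: d1; rewrite e2 ltxx.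
have r1' : r < 1.
  rewrite lt_neqAle r1 andbT; apply/eqP => e; move: tr; rewrite e t1 => /eqP.
  by rewrite oppr_eq0 pnatr_eq0.
exists r; split; first by rewrite r0' r1'.
move=> r2 [/andP[a b] tr2]; case: (ltgtP r r2) => // h.
- have := @t_decreasing r r2; rewrite r0 h tr tr2 (ltW b) => /(_ isT isT).
  by rewrite ltxx.
- have := @t_decreasing r2 r; rewrite (ltW a) h tr tr2 r1 => /(_ isT isT).
  by rewrite ltxx.
Qed.

Lemma t_ge0 r r' : 0 < r' < 1 -> t_ k m p d r' = 0 -> 0 <= r <= r' ->
  0 <= t_ k m p d r.
Proof.
move=> /andP[_ r1] tr /andP[r0]; rewrite le_eqVlt => /orP[/eqP ->|rr]; first by rewrite tr.
by rewrite -tr ltW // t_decreasing ?r0 // ltW.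
Qed.

End RootOfT.

(** The origin of [t_]: [3 / 2 + s / (1 - s) = (3 - s) / (2 (1 - s))], so [q (d + 1)] times it is at
    most 1 exactly under the last hypothesis. The factor [d ^+ 2] of the squares is weakened to
    [d]. *)
Lemma combine_bounds (R : realType) (x y x' y' Q s d q : R) :
  0 <= Q -> 0 <= q -> 0 <= y -> 0 <= d <= 1 -> s < 1 ->
  x' <= d * x -> y' <= d ^+ 2 * y -> x + Q * y <= 3 / 2 + s / (1 - s) ->
  0 <= 2 / (d + 1) * (1 - s) - q * (3 - s) ->
  q * ((x + Q * y) + (x' + Q * y')) <= 1.
Proof.
move=> Q0 q0 y0 /andP[d0 d1] s1 hx hy hxy ht.
have s1' : 0 < 1 - s by rewrite subr_gt0.
have dp : 0 < d + 1 by lra.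
have hy' : y' <= d * y.
  apply: le_trans hy _; rewrite ler_wpM2r // expr2; nra.
have hQ : Q * y' <= Q * (d * y) by rewrite ler_wpM2l.
set T := x + Q * y in hxy *.
have hT : T + (x' + Q * y') <= (d + 1) * T by rewrite /T; lra.
apply: (le_trans (ler_wpM2l q0 hT)).
have hT2 : (d + 1) * T <= (d + 1) * ((3 - s) / (2 * (1 - s))).
  rewrite ler_pM2l //; apply: (le_trans hxy); rewrite le_eqVlt; apply/orP; left.
  by apply/eqP; field; lra.
apply: (le_trans (ler_wpM2l q0 hT2)).
rewrite mulrCA !mulrA ler_pdivrMr ?mulr_gt0 // mul1r.
have : (d + 1) * (q * (3 - s)) <= (d + 1) * (2 / (d + 1) * (1 - s)).
  by rewrite ler_pM2l // -subr_ge0.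
have -> : (d + 1) * (2 / (d + 1) * (1 - s)) = 2 * (1 - s) by field; lra.
by rewrite !mulrA.
Qed.

Section BohrSum.
Variables (R : realType) (k m p : nat).
Local Notation C := R[i].
Local Notation nm := (@Normc.normc R).
Local Notation K := (lac_exp k m p 0).

(** For [n = k + j] the exponent [p (2 n - k) + m] is [K + 2 p j]: one factor [r ^+ K] comes out of
    each sum, and the squares in the variable [r ^+ p] remain. Bounds on partial sums then pass to
    the extended series. *)
Lemma bohr_sums_le (al : R) (a b : nat -> C) (r M : R) :
  0 <= al -> 0 <= r < 1 -> (0 < p)%N ->
  (forall N, r ^+ K * (
    (\sum_(j < N) nm (lac k m p a j) * (r ^+ p) ^+ j
     + ((1 + al)^-1 + r ^+ p / (1 - r ^+ p))
       * \sum_(j < N) (nm (lac k m p a j) * (r ^+ p) ^+ j) ^+ 2)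
    + (\sum_(j < N) nm (lac k m p b j) * (r ^+ p) ^+ j
     + ((1 + al)^-1 + r ^+ p / (1 - r ^+ p))
       * \sum_(j < N) (nm (lac k m p b j) * (r ^+ p) ^+ j) ^+ 2)) <= M) ->
  (bohr_sum k m p al a r + bohr_sum k m p al b r <= M%:E)%E.
Proof.
move=> al0 /andP[r0 r1] p0; set Q := _^-1 + _ => h.
have rp1 : r ^+ p < 1 by rewrite expr_lt1.
have Q0 : 0 <= Q.
  by rewrite addr_ge0 ?invr_ge0 ?addr_ge0 // divr_ge0 ?exprn_ge0 // subr_ge0 ltW.
pose F (c : nat -> C) n := nm (c (p * n + m)%N) * r ^+ (p * n + m)
  + Q * (nm (c (p * n + m)%N) ^+ 2 * r ^+ (p * (2 * n - k) + m)).
have x0 c n : 0 <= nm (c (p * n + m)%N) * r ^+ (p * n + m).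
  by rewrite mulr_ge0 ?nm_ge0 ?exprn_ge0.
have y0 c n : 0 <= nm (c (p * n + m)%N) ^+ 2 * r ^+ (p * (2 * n - k) + m).
  by rewrite mulr_ge0 ?exprn_ge0 // nm_ge0.
have F0 c n : 0 <= F c n by rewrite addr_ge0 // mulr_ge0.
have bE c : bohr_sum k m p al c r = (\sum_(k <= n <oo) (F c n)%:E)%E.
  rewrite /bohr_sum -/Q -nneseriesZl; last by move=> n _; rewrite lee_fin.
  rewrite -nneseriesD //.
  - by move=> n _ _; rewrite lee_fin.
  - by move=> n _ _; rewrite -EFinM lee_fin mulr_ge0.
rewrite !bE -nneseriesD; last 2 first.
- by move=> n _ _; rewrite lee_fin.
- by move=> n _ _; rewrite lee_fin.
apply: lime_le.
  by apply: is_cvg_nneseries => n _ _; rewrite -EFinD lee_fin addr_ge0.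
apply: nearW => N; under eq_bigr do rewrite -EFinD.
rewrite sumEFin lee_fin; apply: le_trans (h (N - k)%N).
rewrite -{1}[k]add0n big_addn big_mkord big_split /= mulrDr.
have FE c : \sum_(j < N - k) F c (j + k)%N =
    r ^+ K * (\sum_(j < N - k) nm (lac k m p c j) * (r ^+ p) ^+ j
      + Q * \sum_(j < N - k) (nm (lac k m p c j) * (r ^+ p) ^+ j) ^+ 2).
  rewrite mulrDr mulrCA !mulr_sumr -big_split; apply: eq_bigr => j _ /=.
  rewrite /F /lac [(j + k)%N]addnC -/(lac_exp k m p j).
  have -> : (p * (2 * (k + j) - k) + m = K + p * j + p * j)%N.
    rewrite /lac_exp; nia.
  move: (nm (c (lac_exp k m p j))) => x; rewrite (lac_expE k m p j) !exprD !exprM; ring.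
by rewrite !FE.
Qed.

End BohrSum.

Theorem theorem3 (R : realType) (k m p : nat)
    (hk : (1 <= k)%N) (hm : (1 <= m)%N) (hp : (1 <= p)%N) (hmp : (m <= p)%N)
    (f h g : Cplx R -> Cplx R) (a b : nat -> R[i]) (d : R)
    (hf : forall z, unit_disc z -> f z = h z + (g z)^*)
    (hharm : harmonic_in_disc f)
    (hh : analytic_in_disc h) (hg : analytic_in_disc g)
    (hexp : has_expansion k m p h a) (gexp : has_expansion k m p g b)
    (hd : 0 <= d <= 1)
    (hdom : forall z : Cplx R, unit_disc z -> z != 0 ->
       Normc.normc (g^`() z) <= d * Normc.normc (h^`() z))
    (hB : classB_ (p * k + m) h) :
  (exists! r' : R, 0 < r' < 1 /\ t_ k m p d r' = 0) /\
  (forall r' : R, 0 < r' < 1 -> t_ k m p d r' = 0 ->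
     forall r : R, 0 <= r <= Num.min r' (1 / (3 `^ (p%:R^-1))) ->
       (M_ k m p a r + N_ k m p a b r <= 1)%E).
Proof.
have /andP[d0 d1] := hd; split; first exact: t_unique_root.
move=> r' r'01 tr' r /andP[r0]; rewrite le_min => /andP[rr' r3].
have /andP[_ r'1] := r'01; have r1 := le_lt_trans rr' r'1.
have t0 : 0 <= t_ k m p d r by apply: (t_ge0 hk hp d0 r'01 tr'); rewrite r0.
have s3 : 0 <= r ^+ p <= 3^-1.
  rewrite exprn_ge0 //=; apply: (@le_trans _ _ ((1 / (3 `^ (p%:R^-1))) ^+ p)).
    by rewrite lerXn2r // nnegrE divr_ge0 // powR_ge0.
  rewrite expr_div_n expr1n -powR_mulrn ?powR_ge0 // -powRrM mulVf ?powRr1 ?div1r //.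
  by rewrite pnatr_eq0 -lt0n.
have /andP[s0 s13] := s3.
set s := r ^+ p in s3 s0 s13.
have s1 : s < 1 by apply: le_lt_trans s13 _; rewrite invf_lt1 ?ltr1n.
have h1 z : Normc.normc z < 1 -> Normc.normc (h z) <= 1.
  move=> z1; have [[_ hsup] _] := hB.
  by move/ereal_supP: hsup => /(_ (Normc.normc (h z))%:E); rewrite lee_fin; apply; exists z.
have alc := lac_contr hp hexp h1.
have dom : exists2 om, contr om & lac_deriv k m p b
    =1 cauchy_prod (fun n => d%:C * lac_deriv k m p a n) om.
  have gG t : 0 < t < 1 -> geo t (lac_deriv k m p b) by exact: geo_lac_deriv gexp.
  have gH t : 0 < t < 1 -> geo t (fun n => d%:C * lac_deriv k m p a n).
    by move=> t01; apply: geoZ; exact: geo_lac_deriv hexp t01.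
  apply: contr_quotient => // w w1.
  have n0 := nm_ge0 w; pose t := (1 + Normc.normc w) / 2.
  have [t01 wt] : 0 < t < 1 /\ Normc.normc w < t.
    by rewrite /t; move: (Normc.normc w) n0 w1 => x x0 x1; split; [apply/andP; split|]; lra.
  have /andP[tp t1] := t01.
  (* The common power of [z] in the derivatives cancels only for [z != 0]; the point 0 is recovered
     by continuity. *)
  apply: (@dom_fill _ _ _ 0 t tp (gG _ t01) (gH _ t01)) wt => x x0 xt.
  have [z zx] := ex_root hp x.
  have z1 : Normc.normc z < 1 by rewrite -(expr_lt1_nm hp) zx (lt_trans xt).
  have z0 : z != 0 by apply: contraNneq x0 => e; rewrite -zx e expr0n gtn_eqF.
  have := hdom z z1 z0; rewrite (expansion_derive1 hm hp gexp z1).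
  rewrite (expansion_derive1 hm hp hexp z1) zx !nmM mulrCA ler_pM2l; last first.
    by rewrite nmX exprn_gt0 // nm_gt0.
  by rewrite (evZ _ xt (geo_lac_deriv hp hexp t01)) nmM nm_real ger0_norm.
have eS n : (lac_exp k m p n <= lac_exp k m p n.+1)%N.
  by rewrite leq_add2r leq_mul2l leq_add2l leqnSn orbT.
apply: bohr_sums_le; rewrite ?nm_ge0 ?r0 // => N; rewrite -/s.
have [X' Y'] := dominated_coefs N d0 s3 (lac_exp_gt0 k p hm 0) eS dom.
have s01 : 0 <= s < 1 by rewrite s0.
have aE : lac k m p a 0 = a (p * k + m)%N by rewrite /lac /lac_exp addn0.
have KE : lac_exp k m p 0 = (p * k + m)%N by rewrite /lac_exp addn0.
have := refined_bohr N alc s01; rewrite aE => hr.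
(* [N_] takes its weight from [a] as well, so a single [Q] serves both sums. *)
rewrite KE; apply: (combine_bounds _ _ _ hd s1 X' Y' hr t0).
- apply: addr_ge0; first by rewrite invr_ge0 addr_ge0 ?nm_ge0.
  by rewrite divr_ge0 ?subr_ge0 ?(ltW s1).
- by rewrite exprn_ge0.
- by apply: sumr_ge0 => n _; exact: sqr_ge0.
Qed.
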